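(* For integers $a,b$ with $a-b\in\{2,0,-2\}$ and $\varepsilon\in\{2,0,-2\}$, $$\psi^{*(2)}_{\varepsilon}(u)^a_b=-\frac{C^4}{4[u][u+1]}\,\frac{\vartheta_3(0|\tau)}{\vartheta_3\left(\frac1r\big|\tau\right)}\,\frac{g_a}{g_b\,(a,b)_2}\sum_{\varepsilon'=0,\pm2}Q^{\varepsilon'}_{\varepsilon}\,\psi^{(2)}_{\varepsilon'}(u-1)^a_b,$$ where $Q^{\varepsilon'}_\varepsilon$ are the entries of the symmetric matrix, with rows and columns indexed by $2,0,-2$ in this order, $$Q=\frac12\begin{pmatrix}1+\eta^2&0&1-\eta^2\\ 0&2\xi^2&0\\ 1-\eta^2&0&1+\eta^2\end{pmatrix},\qquad \xi^2=-\frac12\,\frac{\vartheta_0(0|\tau)\,\vartheta_3\left(\frac1r\big|\tau\right)}{\vartheta_0\left(\frac1r\big|\tau\right)\vartheta_3(0|\tau)},\quad \eta^2=-\frac{\vartheta_2(0|\tau)\,\vartheta_3\left(\frac1r\big|\tau\right)}{\vartheta_2\left(\frac1r\big|\tau\right)\vartheta_3(0|\tau)}.$$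
   Context: Parameters: $K,K',\lambda$ are complex parameters, $x=e^{-\frac{\pi\lambda}{2K}}$, $\tau=\frac{2iK}{K'}$ with $\mathrm{Im}\,\tau>0$, $r=\frac{K'}{\lambda}$. Heights $a,b,c,\dots$ are integers; all identities are understood for values of the parameters for which the denominators occurring do not vanish. Theta functions: with $\tilde p=e^{2\pi i\tau}$ and $(\tilde p;\tilde p)_\infty=\prod_{n\ge1}(1-\tilde p^n)$, $\vartheta_1(u|\tau)=2\tilde p^{1/8}(\tilde p;\tilde p)_\infty\sin\pi u\prod_{n=1}^\infty(1-2\tilde p^n\cos2\pi u+\tilde p^{2n})$, $\vartheta_0(u|\tau)=-ie^{\pi i(u+\tau/4)}\vartheta_1(u+\frac\tau2|\tau)$, $\vartheta_2(u|\tau)=\vartheta_1(u+\frac12|\tau)$, $\vartheta_3(u|\tau)=e^{\pi i(u+\tau/4)}\vartheta_1(u+\frac{\tau+1}2|\tau)$; in $\vartheta_i(\cdot|\frac{\tau}{2})$ one replaces $\tau$ by $\tau/2$ throughout. $[u]=C\,\vartheta_1(\frac{u}{r}|\tau)$ with $C=x^{-r/4}e^{-\pi i/4}\tau^{1/2}$. Gauge factors: $g_a=\varepsilon_a\sqrt{[a]}$ with signs $\varepsilon_a=\pm1$ satisfying $\varepsilon_a\varepsilon_{a+1}=(-1)^a$, and $$(a,b)_2=\left[\begin{matrix}2\\ \frac{a-b+2}{2}\end{matrix}\right]^{-1}\frac{\left[\frac{a+b-2}2,\frac{a+b+2}2\right]}{\sqrt{[a][b]}},\qquad \left[\begin{matrix}A\\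 B\end{matrix}\right]=\frac{[A][A-1]\cdots[A-B+1]}{[B][B-1]\cdots[1]},$$ where $[A,B]=[A][A+1]\cdots[B]$ for $A<B$ (a square root $\sqrt{[a]}$ is fixed for each $a$ and $\sqrt{[a][b]}=\sqrt{[a]}\sqrt{[b]}$). Intertwining vectors: $V=\mathbb{C}v_+\oplus\mathbb{C}v_-$. For $|a-b|=1$, $\psi(u)^a_b=\psi_+(u)^a_bv_++\psi_-(u)^a_bv_-$ with $\psi_+(u)^a_b=\vartheta_0\left(\frac{(a-b)u+a}{2r}\big|\frac\tau2\right)$, $\psi_-(u)^a_b=\vartheta_3\left(\frac{(a-b)u+a}{2r}\big|\frac\tau2\right)$. Dual intertwining vectors: for $|a-b|=1$ and $\varepsilon=\pm$, $\psi^*_\varepsilon(u)^a_b=-\varepsilon\frac{a-b}{2[b][u]}C^2\,\psi_{-\varepsilon}(u-1)^a_b$. Fusion: $\Pi$ is the symmetrizing projection of $V\otimes V$ onto the symmetric tensors $V^{(2)}$, with basis $v^{(2)}_2=v_+\otimes v_+$, $v^{(2)}_0=\frac12(v_+\otimes v_-+v_-\otimes v_+)$, $v^{(2)}_{-2}=v_-\otimes v_-$. For $a-b\in\{2,0,-2\}$, $\psi^{(2)}(u)^a_b=\Pi\,\psi(u+1)^a_c\otimes\psi(u)^c_b=\sum_{\mu=0,\pm2}\psi^{(2)}_\mu(u)^a_b\,v^{(2)}_\mu$, which is independent of the choice of $c$ with $|a-c|=|c-b|=1$. The dual fused vectors are $\psi^{*(2)}_\mu(u)^b_a=\sum_{c}\psi^*_{\varepsilon_1}(u+1)^c_a\,\psi^*_{\varepsilon_2}(u)^b_c$,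 the sum being over $c=a\pm1$ with $|c-b|=1$; this is independent of the choice of $\varepsilon_1,\varepsilon_2\in\{\pm1\}$ with $\varepsilon_1+\varepsilon_2=\mu$. *)

(* Defs.v *)
From HB Require Import structures.
From mathcomp Require Import all_boot all_order all_algebra.
From mathcomp Require Import all_classical all_reals all_analysis.
From mathcomp Require Import complex.

Set Implicit Arguments.
Unset Strict Implicit.
Unset Printing Implicit Defensive.
Import Order.TTheory GRing.Theory Num.Theory.
Import numFieldNormedType.Exports.
Local Open Scope ring_scope.
Local Open Scope classical_set_scope.

(* The topology of R[i] is the one given by its modulus, as for any
   numFieldType. *)
HB.instance Definition _ (R : realType) := NormedModule.copy R[i] R[i]^o.

Section ElementaryFunctions.
Variable R : realType.
Implicit Types z u t : R[i].

Definition piC : R[i] := (pi : R)%:C%C.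

Definition expC z : R[i] :=
  ((expR (complex.Re z) * cos (complex.Im z))
     +i* (expR (complex.Re z) * sin (complex.Im z)))%C.
Definition cosC z : R[i] := (expC ('i * z) + expC (- ('i * z))) / 2.
Definition sinC z : R[i] := (expC ('i * z) - expC (- ('i * z))) / (2 * 'i).

Definition prodinf (f : nat -> R[i]) : R[i] :=
  limn (fun N => \prod_(1 <= n < N.+1) f n).

Definition nome t : R[i] := expC (2 * piC * 'i * t).

(* nome t ^ (1/8) is read as exp (2 pi i t / 8). *)
Definition theta1 u t : R[i] :=
  2 * expC (2 * piC * 'i * t / 8) * prodinf (fun n => 1 - nome t ^+ n)
    * sinC (piC * u)
    * prodinf (fun n => 1 - 2 * nome t ^+ n * cosC (2 * piC * u)
                          + nome t ^+ (2 * n)).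
Definition theta0 u t : R[i] :=
  - 'i * expC (piC * 'i * (u + t / 4)) * theta1 (u + t / 2) t.
Definition theta2 u t : R[i] := theta1 (u + 1 / 2) t.
Definition theta3 u t : R[i] :=
  expC (piC * 'i * (u + t / 4)) * theta1 (u + (t + 1) / 2) t.

End ElementaryFunctions.

Section Tensors.
Variable R : realType.

(* V is 'rV_2; the index 0 stands for the sign +, the index 1 for the sign -,
   so that rev_ord is the change of sign. *)
Definition sgnV (e : 'I_2) : int := nth 0 [:: 1; -1] e.
Definition basisV (e : 'I_2) : 'rV[R[i]]_2 := delta_mx 0 e.

(* V (x) V is 'M_2: the (e1, e2) entry is the coefficient of v_e1 (x) v_e2. *)
Definition tens (v w : 'rV[R[i]]_2) : 'M[R[i]]_2 := v^T *m w.
Definition symproj (T : 'M[R[i]]_2) : 'M[R[i]]_2 := 2^-1 *: (T + T^T).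

(* The indices 0, 1, 2 of 'I_3 stand for the weights 2, 0, -2. *)
Definition weight2 (m : 'I_3) : int := nth 0 [:: 2; 0; -2] m.
Definition basisV2 (m : 'I_3) : 'M[R[i]]_2 :=
  let vp := basisV 0 in let vm := basisV 1 in
  nth 0 [:: tens vp vp; 2^-1 *: (tens vp vm + tens vm vp); tens vm vm] m.

(* Coordinates of a symmetric tensor in basisV2, see coordV2P and coordV2K. *)
Definition coordV2 (T : 'M[R[i]]_2) (m : 'I_3) : R[i] :=
  \sum_(e1 < 2) \sum_(e2 < 2 | sgnV e1 + sgnV e2 == weight2 m) T e1 e2.

Lemma coordV2E (T : 'M[R[i]]_2) (m : 'I_3) :
  coordV2 T m = nth 0 [:: T 0 0; T 0 1 + T 1 0; T 1 1] m.
Proof.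
case: m => [[|[|[|m]]] //= lm]; rewrite /coordV2 !big_ord_recl !big_ord0;
  rewrite big_mkcond [X in _ + (X + _)]big_mkcond !big_ord_recl !big_ord0 /=;
  rewrite !(addr0, add0r); do ?congr (_ + _); by congr (T _ _); apply: val_inj.
Qed.

Lemma basisV2E (m : 'I_3) (i j : 'I_2) :
  basisV2 m i j = (if m == 0 then (i == 0) && (j == 0)
                   else if m == 1 then false else (i == 1) && (j == 1))%:R
                  + (if m == 1 then (i != j)%:R / 2 else 0).
Proof.
rewrite /basisV2 /tens /basisV; case: m => [[|[|[|m]]] //= lm];
  case: i => [[|[|i]] //= li]; case: j => [[|[|j]] //= lj];
  rewrite !mxE /= ?big_ord1 ?mxE /= ?big_ord1 ?mxE /=;
  by rewrite ?(mulr0, mul0r, mulr1, mul1r, addr0, add0r).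
Qed.

Lemma coordV2P (T : 'M[R[i]]_2) :
  T^T = T -> T = \sum_m coordV2 T m *: basisV2 m.
Proof.
move=> symT; apply/matrixP => i j; rewrite summxE.
rewrite (eq_bigr (fun n => coordV2 T n * basisV2 n i j)); last first.
  by move=> n _; rewrite mxE.
rewrite !big_ord_recl big_ord0 !coordV2E !basisV2E /=.
have T10 : T 1 0 = T 0 1 by rewrite -[in LHS]symT mxE.
have two : (T 0 1 + T 0 1) / 2 = T 0 1.
  by rewrite -mulr2n -(mulr_natr (T 0 1)) mulfK ?pnatr_eq0.
case: i => [[|[|i]] //= li]; case: j => [[|[|j]] //= lj];
  rewrite ?(mulr0, mul0r, mulr1, mul1r, addr0, add0r) ?T10 ?two.
- by congr (T _ _); apply: val_inj.
- by congr (T _ _); apply: val_inj.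
- by rewrite -T10; congr (T _ _); apply: val_inj.
- by congr (T _ _); apply: val_inj.
Qed.

Lemma coordV2K (f : 'I_3 -> R[i]) (m : 'I_3) :
  coordV2 (\sum_n f n *: basisV2 n) m = f m.
Proof.
have E (i j : 'I_2) : (\sum_n f n *: basisV2 n) i j
    = \sum_n f n * basisV2 n i j.
  by rewrite summxE; apply: eq_bigr => n _; rewrite mxE.
rewrite coordV2E !E !big_ord_recl !big_ord0 !basisV2E /=.
have two : f (lift ord0 ord0) / 2 + f (lift ord0 ord0) / 2
             = f (lift ord0 ord0) by rewrite -splitr.
by case: m => [[|[|[|m]]] //= lm];
  rewrite ?(mulr0, mul0r, mulr1, mul1r, addr0, add0r) ?two;
  congr (f _); apply: val_inj.
Qed.

End Tensors.

Section Model.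
Variable R : realType.
Variables K K' lam : R[i].
Implicit Types u : R[i].

Definition tau : R[i] := 2 * 'i * K / K'.
Definition rpar : R[i] := K' / lam.

(* x = exp lnx, and powers of x are taken with this logarithm. *)
Definition lnx : R[i] := - (piC R * lam / (2 * K)).
Definition xpow (s : R[i]) : R[i] := expC (s * lnx).

(* sqrtC is the principal branch on the upper half plane. *)
Definition Cst : R[i] :=
  xpow (- (rpar / 4)) * expC (- (piC R * 'i / 4)) * sqrtC tau.

Definition bracket u : R[i] := Cst * theta1 (u / rpar) tau.

Definition brbin_den (B : nat) : R[i] := \prod_(j < B) bracket (B%:R - j%:R).
Definition brbin u (B : nat) : R[i] :=
  (\prod_(j < B) bracket (u - j%:R)) / brbin_den B.

(* [A, B] = [A] [A + 1] ... [B], for A < B. *)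
Definition brprod (A B : int) : R[i] :=
  \prod_(0 <= j < `|B - A|%N.+1) bracket (A%:~R + j%:R).

(* In the next two definitions sq h is a chosen square root of [h]. *)
Definition gauge (eps sq : int -> R[i]) (a : int) : R[i] := eps a * sq a.

Definition gauge2_idx (a b : int) : nat := `|((a - b + 2) %/ 2)%Z|%N.
Definition gauge2 (sq : int -> R[i]) (a b : int) : R[i] :=
  (brbin 2 (gauge2_idx a b))^-1
    * (brprod ((a + b - 2) %/ 2)%Z ((a + b + 2) %/ 2)%Z / (sq a * sq b)).

(* In all vectors below u a b stands for (u)^a_b. *)
Definition psi u (a b : int) : 'rV[R[i]]_2 :=
  \row_(e < 2)
    (if e == 0 then @theta0 R else @theta3 R)
      (((a - b)%:~R * u + a%:~R) / (2 * rpar)) (tau / 2).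

Definition psistar u (a b : int) (e : 'I_2) : R[i] :=
  - (sgnV e)%:~R * ((a - b)%:~R / (2 * bracket b%:~R * bracket u))
    * Cst ^+ 2 * psi (u - 1) a b 0 (rev_ord e).

(* The fused vector, computed with the intermediate height c. *)
Definition psi2 u (a c b : int) (m : 'I_3) : R[i] :=
  coordV2 (symproj (tens (psi (u + 1) a c) (psi u c b))) m.

(* The dual fused vector of weight sgnV e1 + sgnV e2, computed with the signs
   e1 and e2. *)
Definition psi2star u (a b : int) (e1 e2 : 'I_2) : R[i] :=
  \sum_(c <- [:: b + 1; b - 1] | `|c - a| == 1)
    psistar (u + 1) c b e1 * psistar u a c e2.

Definition xi2 : R[i] :=
  - (1 / 2) * ((theta0 0 tau * theta3 (1 / rpar) tau)
               / (theta0 (1 / rpar) tau * theta3 0 tau)).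
Definition eta2 : R[i] :=
  - ((theta2 0 tau * theta3 (1 / rpar) tau)
     / (theta2 (1 / rpar) tau * theta3 0 tau)).

Definition Qmx : 'M[R[i]]_3 :=
  2^-1 *: \matrix_(i, j)
    (nth [::] [:: [:: 1 + eta2; 0;       1 - eta2];
                  [:: 0;        2 * xi2; 0       ];
                  [:: 1 - eta2; 0;       1 + eta2]] i)`_j.

End Model.

(* Main.v *)
(** Put [T(q, z) = \sum_k q^(k^2) z^k], the sum being over all integers [k], and
    [q = exp (pi i t)]. By Jacobi's triple product every theta function of
    modulus [t] is an exponential factor times a value of [T(q, .)]. Sorting
    the pairs [(m, n)] of the double series by the parity of [m + n] gives
      [T(q, z) T(q, w) = T(q^2, z w) T(q^2, z / w)
                         + q z T(q^2, q^2 z w) T(q^2, q^2 z / w)],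
    which is used twice. At modulus [tau / 2] it turns each product of two
    components of intertwining vectors, with arguments [x] and [y], into a
    combination of the products [theta_i (x + y) theta_i (x - y)] of modulus
    [tau], and [Q] multiplies such a product by [theta_i 0 / theta_i (1 / r)]
    up to sign. If [a - b = 2] or [a - b = -2], the dual vectors have [x - y = 0]
    while the fused ones have [x - y] equal to [1 / r] or [- 1 / r], and this is
    the theorem. If [a = b], the sum over the two intermediate heights remains.
    At modulus [tau], the same identity writes [theta_1 (x + y) theta_1 (x - y)]
    as a 2 x 2 minor, so the Pluecker relation gives Weierstrass' three-term
    identity, whose half-period cases evaluate that sum. *)

Require Import Defs.
From HB Require Import structures.
From mathcomp Require Import all_boot all_order all_algebra.
From mathcomp Require Import all_classical all_reals all_analysis.
From mathcomp Require Import complex.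
From mathcomp Require Import ring lra zify.
Set Implicit Arguments.
Unset Strict Implicit.
Unset Printing Implicit Defensive.
Import Order.TTheory GRing.Theory Num.Theory.
Import numFieldNormedType.Exports.
Local Open Scope ring_scope.

(** * Sequences, products and dominated sums in R[i] *)

Section ComplexSequences.
Context {R : realType}.
Implicit Types (u : nat -> R[i]) (z : R[i]).

Lemma normc_real (x : R) : `|x%:C%C| = (`|x|)%:C%C.
Proof. by rewrite normc_def /= expr0n /= addr0 sqrtr_sqr. Qed.

Lemma normc_ge_Im z : `|complex.Im z|%:C%C <= `|z|.
Proof.
have -> : `|z| = `|z * 'i%C| by rewrite normrM complexiE normCi mulr1.
by have := normc_ge_Re (z * 'i%C); rewrite ReiNIm normrN.
Qed.

Lemma gt0_real_complex (e : R[i]) : 0 < e -> exists2 r : R, 0 < r & e = r%:C%C.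
Proof.
move=> e0; exists (complex.Re e); last by rewrite RRe_real // gtr0_real.
by move: e0; rewrite ltcE => /andP[].
Qed.

Lemma cvg_real_complex (r : nat -> R) (l : R) :
  (r n @[n --> \oo] --> l -> (r n)%:C%C @[n --> \oo] --> l%:C%C)%classic.
Proof.
move=> /cvgrPdist_le rl; apply/cvgrPdist_le => _ /gt0_real_complex[e e0 ->].
by apply: filterS (rl e e0) => n; rewrite -rmorphB /= normc_real lecR.
Qed.

Lemma cvgC_norm0 u :
  (forall e : R, 0 < e -> (\forall n \near \oo, `|u n| <= e%:C%C)%classic) ->
  (u n @[n --> \oo] --> (0 : R[i]))%classic.
Proof.
by move=> H; apply/cvgr0Pnorm_le => _ /gt0_real_complex[e e0 ->]; exact: H.
Qed.

Lemma cvgC_ReIm u :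
  (cvgn (fun n => complex.Re (u n)) -> cvgn (fun n => complex.Im (u n)) ->
   cvgn u)%classic.
Proof.
move=> /cvg_ex[x ux] /cvg_ex[y uy]; apply/cvg_ex.
exists (x%:C + 'i * y%:C)%C.
have -> : u = fun n => ((complex.Re (u n))%:C + 'i * (complex.Im (u n))%:C)%C.
  by apply/funext => n; rewrite -complexE.
by apply: cvgD; [exact: cvg_real_complex|apply: cvgMr; exact: cvg_real_complex].
Qed.

(** The comparison test is applied over [R] to the real and imaginary parts, each bounded by the
    modulus of the term. *)
Lemma normc_cvg_series u (v : nat -> R) :
  (forall n, `|u n| <= (v n)%:C%C) -> cvgn (series v) -> cvgn (series u).
Proof.
move=> uv cv.
have v0 n : 0 <= v n by rewrite -ler0c (le_trans _ (uv n)).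
have ReD (x y : R[i]) : complex.Re (x + y) = complex.Re x + complex.Re y.
  by case: x y => [? ?] [].
have ImD (x y : R[i]) : complex.Im (x + y) = complex.Im x + complex.Im y.
  by case: x y => [? ?] [].
apply: cvgC_ReIm.
- have -> : (fun n => complex.Re (series u n)) = series (fun n => complex.Re (u n)).
    apply/funext => n; rewrite /series /=.
    by apply: (big_morph (@complex.Re R)).
  apply: normed_cvg; apply: series_le_cvg cv => // n; first exact: normr_ge0.
  by rewrite /= -lecR; exact: le_trans (normc_ge_Re _) (uv n).
- have -> : (fun n => complex.Im (series u n)) = series (fun n => complex.Im (u n)).
    apply/funext => n; rewrite /series /=.
    by apply: (big_morph (@complex.Im R)).
  apply: normed_cvg; apply: series_le_cvg cv => // n; first exact: normr_ge0.
  by rewrite /= -lecR; exact: le_trans (normc_ge_Im _) (uv n).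
Qed.

Lemma geometric_partial_sum_le (M rho : R) (n : nat) :
  0 <= M -> 0 <= rho < 1 -> \sum_(0 <= k < n) M * rho ^+ k <= M / (1 - rho).
Proof.
move=> M0 /andP[r0 r1].
have := geometric_seriesE M (negbT (lt_eqF r1)) => /(congr1 (fun f => f n)).
rewrite /series /= => ->.
have d0 : 0 < 1 - rho by rewrite subr_gt0.
by rewrite ler_pM2r ?invr_gt0// ler_piMr// lerBlDr lerDl exprn_ge0.
Qed.

(** Since [1 + x <= expR x], all partial products are bounded by [expR (M / (1 - rho))]. Consecutive
    partial products [P n] and [P n.+1] differ by [P n * a n.+1], so the telescoping series of
    differences is dominated by a geometric one. *)
Lemma cvg_prod_geometric (a : nat -> R[i]) (M rho : R) :
  0 <= rho < 1 -> (forall n, `|a n| <= (M * rho ^+ n)%:C%C) ->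
  cvgn (fun N => \prod_(1 <= n < N.+1) (1 + a n)).
Proof.
move=> rho01 aM; have [r0 r1] := andP rho01.
have M0 : 0 <= M by have := le_trans (normr_ge0 _) (aM 0%N); rewrite mulr1 ler0c.
pose P N := \prod_(1 <= n < N.+1) (1 + a n).
pose B := expR (M / (1 - rho)).
have PB N : `|P N| <= B%:C%C.
  apply: (@le_trans _ _ (expR (\sum_(0 <= n < N.+1) M * rho ^+ n))%:C%C); last first.
    by rewrite lecR ler_expR geometric_partial_sum_le.
  apply: (@le_trans _ _ (expR (\sum_(1 <= n < N.+1) M * rho ^+ n))%:C%C); last first.
    by rewrite lecR ler_expR [leRHS]big_ltn// lerDr mulr1.
  rewrite /P; elim: N => [|N IH]; first by rewrite !big_geq// normr1 expR0.
  rewrite !(big_nat_recr N.+1)//= normrM expRD rmorphM /=.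
  apply: ler_pM => //.
  apply: le_trans (ler_normD _ _) _; rewrite normr1.
  apply: (@le_trans _ _ (1 + M * rho ^+ N.+1)%:C%C).
    by rewrite rmorphD /= lerD2l aM.
  by rewrite lecR expR_ge1Dx.
have -> : (fun N => \prod_(1 <= n < N.+1) (1 + a n))
        = (fun N => P 0%N + series (telescope P) N).
  by apply/funext => N; rewrite -eq_sum_telescope.
apply: is_cvgD; first exact: is_cvg_cst.
apply: (@normc_cvg_series _ (geometric (B * M * rho) rho)).
  move=> n; rewrite /telescope /P /= [in X in X - _]big_nat_recr//= -/(P n).
  rewrite -{2}[P n]mulr1 -mulrBr (addrC 1) addrK normrM.
  rewrite -!mulrA -exprS rmorphM /=.
  by apply: ler_pM.
by apply: is_cvg_geometric_series; rewrite ger0_norm.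
Qed.

End ComplexSequences.

Section DominatedSums.
Context {R : realType}.

Lemma ler_sum_uniq_subset (V : numDomainType) (I : eqType) (G : I -> V) (F S : seq I) :
  (forall i, 0 <= G i) -> uniq F -> {subset F <= S} ->
  \sum_(i <- F) G i <= \sum_(i <- S) G i.
Proof.
move=> G0; elim: F S => [|x F IH] S /=.
  by move=> _ _; rewrite big_nil sumr_ge0.
move=> /andP[xF uF] sub.
have xS : x \in S by apply: sub; rewrite mem_head.
rewrite big_cons (perm_big _ (perm_to_rem xS)) big_cons lerD2l.
apply: IH => // y yF.
have yS : y \in S by apply: sub; rewrite inE yF orbT.
have := perm_mem (perm_to_rem xS) y; rewrite yS inE => /esym/orP[/eqP yx|//].
by move: xF; rewrite -yx yF.
Qed.

(** Summability is a common bound on the sums over all finite duplicate-free lists. This form fixes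
    no enumeration of [I] and so serves [int] and [int * int] alike. *)
Definition summable_seq {I : eqType} (G : I -> R) :=
  (forall i, 0 <= G i) /\
  exists M : R, forall F : seq I, uniq F -> \sum_(i <- F) G i <= M.

(** Take [F] whose sum is within [e] of the supremum of all finite sums: a list disjoint from [F]
    can then add at most [e]. *)
Lemma summable_seq_tail (I : eqType) (G : I -> R) (e : R) :
  summable_seq G -> 0 < e ->
  exists F : seq I, forall H : seq I, uniq H -> {in H, forall i, i \notin F} ->
    \sum_(i <- H) G i <= e.
Proof.
move=> [G0 [M GM]] e0.
pose E : set R := [set x | exists2 F : seq I, uniq F & x = \sum_(i <- F) G i]%classic.
have supE : has_sup E.
  split; first by exists (\sum_(i <- [::]) G i); exists [::].
  by exists M => _ [F uF ->]; exact: GM.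
have [_ [F uF ->] ltF] := sup_adherent e0 supE.
exists F => H uH HF.
have uFH : uniq (F ++ H).
  rewrite cat_uniq uF uH andbT /=; apply/hasPn => i iH; exact: HF.
have : \sum_(i <- F ++ H) G i <= sup E.
  by apply: sup_upper_bound => //; exists (F ++ H).
rewrite big_cat /=; lra.
Qed.

(** Dominated convergence where both the terms and the index set move with [N]. Outside a fixed
    finite [F] the dominating tail is at most [e / 2]; inside [F] there are finitely many null
    sequences. *)
Lemma cvg_dominated_sum (I : eqType) (G : I -> R) (S : nat -> seq I)
    (a : nat -> I -> R[i]) :
  summable_seq G -> (forall N, uniq (S N)) ->
  (forall N i, `|a N i| <= (G i)%:C%C) ->
  (forall i, a N i @[N --> \oo] --> (0 : R[i]))%classic ->
  (\sum_(i <- S N) a N i @[N --> \oo] --> (0 : R[i]))%classic.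
Proof.
move=> sG uS aG a0; apply: cvgC_norm0 => e e0.
have e20 : 0 < e / 2 by rewrite divr_gt0.
have [F FH] := summable_seq_tail sG e20.
have aF : (\sum_(i <- undup F) `|a N i| @[N --> \oo] --> (0 : R[i]))%classic.
  elim: (undup F) => [|i s IH].
    by under eq_fun do rewrite big_nil; exact: cvg_cst.
  under eq_fun do rewrite big_cons.
  have -> : nbhs (0 : R[i]) = nbhs (`|0 : R[i]| + 0 : R[i]) by rewrite normr0 addr0.
  apply: cvgD; last exact: IH.
  apply: cvg_norm; exact: a0.
have e2C : 0 < (e / 2)%:C%C by rewrite ltcR.
move/cvgr0Pnorm_le : aF => /(_ _ e2C); apply: filterS => N.
rewrite ger0_norm ?sumr_ge0// => HN.
apply: le_trans (ler_norm_sum _ _ _) _.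
rewrite (bigID (mem F)) /= (splitr e) rmorphD /=; apply: lerD.
  apply: le_trans HN; rewrite -big_filter.
  have uf := filter_uniq (mem F) (uS N).
  have sf : {subset [seq i <- S N | i \in F] <= undup F}.
    by move=> i; rewrite mem_filter mem_undup => /andP[].
  exact: ler_sum_uniq_subset.
rewrite -big_filter.
apply: (@le_trans _ _ (\sum_(i <- [seq i <- S N | i \notin F]) (G i)%:C%C)).
  exact: ler_sum.
rewrite -(rmorph_sum (real_complex R)) lecR; apply: FH.
  exact: filter_uniq.
by move=> i; rewrite mem_filter => /andP[].
Qed.

End DominatedSums.

(** * Independence of a sum from the order of summation *)

Section Exhaustion.
Context {R : realType}.

Definition exhausting {I : eqType} (S : nat -> seq I) :=
  (forall N, uniq (S N)) /\ forall i, (\forall N \near \oo, i \in S N)%classic.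

(** The two partial sums differ by a sum over the union of [S N] and [S' N] whose coefficient at [i]
    is the difference of the two indicators. Each coefficient is eventually 0, so dominated
    convergence makes the difference vanish. *)
Lemma cvg_exhausting_sum (I : eqType) (G : I -> R) (f : I -> R[i])
    (S S' : nat -> seq I) (l : R[i]) :
  summable_seq G -> (forall i, `|f i| <= (G i)%:C%C) ->
  exhausting S -> exhausting S' ->
  (\sum_(i <- S N) f i @[N --> \oo] --> l ->
   \sum_(i <- S' N) f i @[N --> \oo] --> l)%classic.
Proof.
move=> sG fG [uS xS] [uS' xS'] Sl.
pose a N i := ((i \in S' N)%:R - (i \in S N)%:R) * f i.
pose T N := undup (S N ++ S' N).
have restr N (U : seq I) : uniq U -> {subset U <= T N} ->
    \sum_(i <- T N) (i \in U)%:R * f i = \sum_(i <- U) f i.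
  move=> uU sU; rewrite (bigID (mem U)) /= [X in _ + X]big1 ?addr0; last first.
    by move=> i /negbTE ->; rewrite mul0r.
  rewrite -big_filter (eq_big_seq f); last first.
    by move=> i; rewrite mem_filter => /andP[/= -> _]; rewrite mul1r.
  apply: perm_big; apply: uniq_perm => //; first by rewrite filter_uniq ?undup_uniq.
  by move=> i; rewrite mem_filter /=; case: (boolP (i \in U)) => //= /sU.
have diff N : \sum_(i <- S' N) f i =
    \sum_(i <- S N) f i + \sum_(i <- T N) a N i.
  rewrite /a; under [X in _ = _ + X]eq_bigr do rewrite mulrBl.
  rewrite sumrB (restr _ (S' N)) ?(restr _ (S N))//; first by rewrite addrC subrK.
    by move=> i iS; rewrite mem_undup mem_cat iS.
  by move=> i iS; rewrite mem_undup mem_cat iS orbT.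
under eq_fun do rewrite diff.
rewrite -[l]addr0; apply: cvgD; first exact: Sl.
apply: (@cvg_dominated_sum _ _ G); first exact: sG.
- by move=> N; rewrite undup_uniq.
- move=> N i; rewrite normrM -[leRHS]mul1r ler_pM//.
  by case: (_ \in _); case: (_ \in _); rewrite ?subrr ?subr0 ?sub0r ?normrN ?normr0 ?normr1.
- move=> i; apply: cvg_near_cst; near=> N; rewrite /a.
  have -> : i \in S N by near: N; exact: xS.
  have -> : i \in S' N by near: N; exact: xS'.
  by rewrite subrr mul0r.
Unshelve. all: by end_near.
Qed.

(** A finite set of pairs lies in the product of its two projections, over which the double sum
    factors. *)
Lemma summable_seq_prod (I J : eqType) (G : I -> R) (H : J -> R) :
  summable_seq G -> summable_seq H ->
  summable_seq (fun p : I * J => G p.1 * H p.2).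
Proof.
move=> [G0 [M GM]] [H0 [M' HM]]; split; first by move=> p; rewrite mulr_ge0.
exists (M * M') => F uF.
pose F1 := undup [seq p.1 | p <- F]; pose F2 := undup [seq p.2 | p <- F].
apply: (@le_trans _ _ (\sum_(p <- [seq (i, j) | i <- F1, j <- F2]) G p.1 * H p.2)).
  apply: ler_sum_uniq_subset => //; first by move=> p; rewrite mulr_ge0.
  move=> [i j] ijF; apply/allpairsP; exists (i, j); split => //=;
    rewrite mem_undup; apply/mapP; by exists (i, j).
rewrite big_allpairs /=; under eq_bigr do rewrite -mulr_sumr.
rewrite -mulr_suml; apply: ler_pM; rewrite ?sumr_ge0//.
  by apply: GM; rewrite undup_uniq.
by apply: HM; rewrite undup_uniq.
Qed.

Lemma summable_seqZ (I : eqType) (G : I -> R) (c : R) :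
  0 <= c -> summable_seq G -> summable_seq (fun i => c * G i).
Proof.
move=> c0 [G0 [M GM]]; split; first by move=> i; rewrite mulr_ge0.
by exists (c * M) => F uF; rewrite -mulr_sumr ler_wpM2l// GM.
Qed.

Lemma summable_geometric_int : summable_seq (fun k : int => 2^-1 ^+ absz k : R).
Proof.
have h01 : 0 <= (2^-1 : R) < 1 by rewrite invr_ge0 ler0n invf_lt1 ?ltr1n.
split; first by move=> k; rewrite exprn_ge0//; lra.
exists (1 / (1 - 2^-1) + 1 / (1 - 2^-1)) => F uF.
have [n Fn] : exists n, forall k, k \in F -> (absz k < n)%N.
  exists (\max_(k <- F) absz k).+1 => k kF.
  by rewrite ltnS; apply: (@leq_bigmax_seq _ F xpredT absz k).
(* Two geometric series cover the two signs. As [absz (Negz i)] is [i.+1], the negative half has a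
   factor [2^-1] to spare. *)
apply: (@le_trans _ _ (\sum_(k <- map Posz (iota 0 n) ++ map Negz (iota 0 n))
   2^-1 ^+ absz k)).
  apply: ler_sum_uniq_subset => //.
  move=> k /Fn; rewrite mem_cat; case: k => [k|k] kn; apply/orP.
    by left; apply/mapP; exists k; rewrite // mem_iota.
  by right; apply/mapP; exists k; rewrite // mem_iota add0n; apply: ltn_trans kn.
have geo := geometric_partial_sum_le n (@ler01 R) h01.
rewrite /index_iota subn0 in geo.
rewrite big_cat !big_map; apply: lerD; apply: le_trans geo.
  by apply: ler_sum => i _; rewrite mul1r.
apply: ler_sum => i _; rewrite mul1r [_ ^+ absz _]exprS ler_piMl ?exprn_ge0//; lra.
Qed.

Definition window N : seq int := [seq i%:Z - N%:Z | i <- iota 0 (2 * N).+1].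

Lemma mem_window N (k : int) : (k \in window N) = (absz k <= N)%N.
Proof.
apply/mapP/idP => [|kN]; first by case=> i; rewrite mem_iota => ? ->; lia.
exists (absz (k + N%:Z)); last by lia.
by rewrite mem_iota; lia.
Qed.

Lemma exhausting_window : exhausting window.
Proof.
split=> [N|k]; first by rewrite map_inj_uniq ?iota_uniq// => i j; lia.
by exists (absz k) => // N /= kN; rewrite mem_window.
Qed.

Lemma sum_window (V : zmodType) N (F : int -> V) :
  \sum_(k <- window N) F k = \sum_(0 <= i < (2 * N).+1) F (i%:Z - N%:Z).
Proof. by rewrite big_map /index_iota subn0. Qed.

Lemma exhausting_map (I J : eqType) (g : I -> J) (h : J -> I) (S : nat -> seq I) :
  cancel g h -> cancel h g -> exhausting S -> exhausting (fun N => map g (S N)).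
Proof.
move=> gK hK [uS xS]; split=> [N|j]; first by rewrite map_inj_uniq//; exact: can_inj gK.
by apply: filterS (xS (h j)) => N jS; rewrite -(hK j) map_f.
Qed.

Lemma exhausting_allpairs (I J : eqType) (S : nat -> seq I) (T : nat -> seq J) :
  exhausting S -> exhausting T ->
  exhausting (fun N => [seq (i, j) | i <- S N, j <- T N]).
Proof.
move=> [uS xS] [uT xT]; split=> [N|[i j]].
  by apply: allpairs_uniq => // -[? ?] [? ?].
near=> N; apply/allpairsP; exists (i, j); split=> //=; near: N.
  exact: xS.
exact: xT.
Unshelve. all: by end_near.
Qed.

End Exhaustion.

(** * Jacobi's triple product *)

Section QProducts.
Variable F : fieldType.
Implicit Types p q x z : F.

(** The finite q-Pochhammer symbol [(p; p)_N]; [qbin] below is the Gaussian binomial coefficient of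
    base [p]. *)
Definition qpoch p N := \prod_(1 <= n < N.+1) (1 - p ^+ n).

Lemma qpochS p N : qpoch p N.+1 = qpoch p N * (1 - p ^+ N.+1).
Proof. by rewrite /qpoch big_nat_recr. Qed.

Lemma qpoch0 p : qpoch p 0 = 1.
Proof. by rewrite /qpoch big_geq. Qed.

Definition qbin p n k :=
  if (k <= n)%N then qpoch p n / (qpoch p k * qpoch p (n - k)) else 0.

Section Pascal.
Variable p : F.
Hypothesis p_nroot : forall n, p ^+ n.+1 != 1.

Lemma qpoch_neq0 N : qpoch p N != 0.
Proof.
elim: N => [|N IH]; first by rewrite qpoch0 oner_eq0.
by rewrite qpochS mulf_neq0// subr_eq0 eq_sym.
Qed.

Lemma qbinn0 n : qbin p n 0 = 1.
Proof. by rewrite /qbin /= subn0 qpoch0 mul1r divff// qpoch_neq0. Qed.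

Lemma qbinS n k : (k <= n)%N ->
  qbin p n.+1 k.+1 = qbin p n k.+1 + p ^+ (n - k) * qbin p n k.
Proof.
move=> kn; rewrite /qbin ltnS kn subSS.
(* The case [k = n] is separate: there [qbin p n k.+1] takes its default value 0. *)
have e0 := qpoch_neq0; have := kn; rewrite leq_eqVlt => /orP[/eqP <-|kn'].
  by rewrite ltnn subnn expr0 add0r mul1r qpoch0 !mulr1 !divff.
rewrite kn'; have [m nk] : exists m, n = (k + m).+1 by exists (n - k.+1)%N; lia.
have -> : (n - k = m.+1)%N by lia.
have -> : (n - k.+1 = m)%N by lia.
rewrite (qpochS p n) (qpochS p k) (qpochS p m) nk.
have -> : p ^+ (k + m).+2 = p ^+ k.+1 * p ^+ m.+1 by rewrite -exprD; congr (_ ^+ _); lia.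
have [ek em] := (e0 k, e0 m).
have pk : 1 - p ^+ k.+1 != 0 by rewrite subr_eq0 eq_sym.
have pm : 1 - p ^+ m.+1 != 0 by rewrite subr_eq0 eq_sym.
by field; rewrite ek em pk pm.
Qed.

End Pascal.

(** Induction on [n] by the q-Pascal rule [qbinS]: one half of the split sum rebuilds the previous
    polynomial, the other is that polynomial times [x * q ^+ (2 * n)]. The base [q ^+ 2] turns the
    exponent [k (k - 1) / 2] of the usual formula into an integral power of [q]. *)
Lemma gauss_binomial q x n : (forall n, (q ^+ 2) ^+ n.+1 != 1) ->
  \prod_(0 <= j < n) (1 + x * q ^+ (2 * j)) =
  \sum_(0 <= k < n.+1) q ^+ (k * k.-1) * qbin (q ^+ 2) n k * x ^+ k.
Proof.
move=> hp; elim: n => [|n IH].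
  by rewrite big_geq// big_nat1 qbinn0// !mulr1.
rewrite big_nat_recr//= IH mulrDr mulr1 [RHS]big_nat_recl//= qbinn0//.
under [in RHS]eq_big_nat => k /andP[_ kn].
  rewrite qbinS// mulrDr mulrDl; over.
rewrite big_split /= addrA; congr (_ + _).
  rewrite [LHS]big_nat_recl//= qbinn0//; congr (_ + _).
  by rewrite [RHS]big_nat_recr//= /qbin ltnn mulr0 mul0r addr0.
rewrite mulr_suml; apply: eq_big_nat => k /andP[_ kn].
have -> : q ^+ (2 * n) = q ^+ (2 * k) * (q ^+ 2) ^+ (n - k).
  by rewrite -exprM -exprD; congr (_ ^+ _); lia.
have -> : q ^+ (k.+1 * k) = q ^+ (k * k.-1) * q ^+ (2 * k).
  by rewrite -exprD; congr (_ ^+ _); case: (k) => //= m; lia.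
by rewrite (exprS x k); ring.
Qed.

Definition tterm q z (k : int) := q ^+ (absz k ^ 2) * z ^ k.

Definition jprod q z N :=
  \prod_(1 <= n < N.+1) ((1 + z * q ^+ (2 * n - 1)) * (1 + z^-1 * q ^+ (2 * n - 1))).

(* Gauss' formula for [2 N] factors, at [x = z q^(1 - 2 N)]. *)
Lemma finite_jacobi q z N : (forall n, (q ^+ 2) ^+ n.+1 != 1) ->
  q != 0 -> z != 0 ->
  jprod q z N = \sum_(0 <= i < (2 * N).+1)
     tterm q z (i%:Z - N%:Z) * qbin (q ^+ 2) (2 * N) i.
Proof.
move=> hq q0 z0.
pose x := z * q / q ^+ (2 * N).
have qn m : q ^+ m != 0 by rewrite expf_neq0.
have -> : jprod q z N =
    (z ^+ N)^-1 * q ^+ (N ^ 2) * \prod_(0 <= j < 2 * N) (1 + x * q ^+ (2 * j)).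
  (* The lower half of the product, read backwards, is paired with the upper half. A lower factor
     [1 + z q^-(2 i + 1)] becomes [1 + z^-1 q^(2 i + 1)] after multiplication by [z^-1 q^(2 i + 1)],
     and these monomials make up the prefactor. *)
  rewrite (big_cat_nat (n := N))//=; last by lia.
  have -> : \prod_(N <= j < 2 * N) (1 + x * q ^+ (2 * j)) =
      \prod_(0 <= j < N) (1 + x * q ^+ (2 * (j + N))).
    by rewrite -{1}[N]add0n big_addn; have -> : (2 * N - N = N)%N by lia.
  rewrite big_nat_rev /= add0n.
  rewrite -big_split /= /jprod big_add1 /=.
  have -> : (z ^+ N)^-1 * q ^+ (N ^ 2) = \prod_(0 <= i < N) (z^-1 * q ^+ (2 * i).+1).
    rewrite big_split /= prodr_const_nat subn0 exprVn; congr (_ * _).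
    elim: (N) => [|m IH]; first by rewrite big_geq.
    by rewrite big_nat_recr//= -IH -exprD; congr (_ ^+ _); lia.
  rewrite -big_split /=; apply: eq_big_nat => i /andP[_ iN].
  have -> : (2 * i.+1 - 1 = (2 * i).+1)%N by lia.
  rewrite /x.
  have -> : q ^+ (2 * N) = q ^+ (2 * (N - i.+1)) * q ^+ (2 * i).+2.
    by rewrite -exprD; congr (_ ^+ _); lia.
  have -> : q ^+ (2 * (i + N)) = q ^+ (2 * (N - i.+1)) * q ^+ (2 * i).+2 * q ^+ (2 * i).
    by rewrite -!exprD; congr (_ ^+ _); lia.
  rewrite !(exprS _ (2 * i).+1) !(exprS _ (2 * i)).
  have := qn (2 * i)%N; have := qn (2 * (N - i.+1))%N.
  move: (q ^+ _) (q ^+ _) => a b a0 b0.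
  by field; rewrite z0 q0 a0 b0.
rewrite gauss_binomial// mulr_sumr; apply: eq_big_nat => i /andP[_ iN].
rewrite /tterm /x !exprMn exprVn -!exprM.
have -> : z ^ (i%:Z - N%:Z) = z ^+ i * (z ^+ N)^-1 by rewrite expfzDr// -exprnN.
have -> : q ^+ (absz (i%:Z - N%:Z) ^ 2) =
  q ^+ (N ^ 2) * q ^+ (i * i.-1) * q ^+ i / q ^+ (2 * N * i).
  apply: (mulIf (qn (2 * N * i)%N)); rewrite divfK// -!exprD.
  congr (_ ^+ _); case: (i) => [|m] /=; nia.
by ring.
Qed.

End QProducts.

Section Jacobi.
Context {R : realType}.
Implicit Types (q z : R[i]) (N : nat) (k : int).

Lemma normc_ReE z : `|z| = (complex.Re `|z|)%:C%C.
Proof. by rewrite RRe_real ?normr_real. Qed.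

Lemma Re_norm_itv q : `|q| < 1 -> 0 <= complex.Re `|q| < 1.
Proof. by move=> q1; rewrite -ler0c -normc_ReE normr_ge0 /= -ltcR -normc_ReE. Qed.

(** After multiplication by [2 ^+ n] the left side is the [n]-th power of [rho ^+ n * (2 * r)]. That
    base is at most 1 from some [K] on, and the constant [(2 * r) ^+ K] absorbs the earlier
    indices. *)
Lemma gauss_weight_le (rho r : R) : 0 <= rho < 1 -> 1 <= r ->
  exists2 c : R, 0 <= c & forall n, rho ^+ (n ^ 2) * r ^+ n <= c * 2^-1 ^+ n.
Proof.
move=> /andP[rho0 rho1] r1.
have r20 : 0 < 2 * r by lra.
have : (rho ^+ n @[n --> \oo] --> (0 : R))%classic.
  by apply: cvg_expr; rewrite ger0_norm.
have e0 : 0 < (2 * r)^-1 by rewrite invr_gt0.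
move=> /cvgr0Pnorm_le /(_ _ e0) [K _ HK].
have r21 : 1 <= 2 * r by lra.
have pn0 n : 0 <= rho ^+ n * (2 * r) by rewrite mulr_ge0 ?exprn_ge0 ?(ltW r20).
exists ((2 * r) ^+ K); first by rewrite exprn_ge0// ltW.
move=> n; rewrite exprVn ler_pdivlMr ?exprn_gt0//.
rewrite -mulrA -exprMn [r * 2]mulrC -mulnn exprM -exprMn.
have [Kn|nK] := leqP K n; last first.
  apply: (@le_trans _ _ ((2 * r) ^+ n)); last by rewrite ler_weXn2l// ltnW.
  by rewrite lerXn2r ?nnegrE ?(ltW r20) ?pn0// ger_pMl// exprn_ile1// ltW.
apply: (@le_trans _ _ 1); last by rewrite exprn_ege1.
have := HK n Kn; rewrite /= ger0_norm ?exprn_ge0// => H.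
rewrite exprn_ile1 ?pn0//.
by rewrite -ler_pdivlMr// div1r.
Qed.

Lemma norm_exprz_le z (r : R) k :
  `|z| <= r%:C%C -> `|z^-1| <= r%:C%C -> `|z ^ k| <= (r ^+ absz k)%:C%C.
Proof.
move=> zr zr'; rewrite rmorphXn /=.
have r0 : 0 <= (r%:C)%C by apply: le_trans zr.
case: k => n; first by rewrite normrX lerXn2r// nnegrE.
by rewrite NegzE -exprnN -exprVn normrX lerXn2r// nnegrE.
Qed.

(** The quadratic exponent of [q] beats any exponential growth of [z ^ k]. Here [r] is chosen to be
    at least 1, [|z|] and [|z^-1|], which treats both signs of [k] at once. *)
Lemma tterm_le q z : `|q| < 1 ->
  exists2 c : R, 0 <= c & forall k, `|tterm q z k| <= (c * 2^-1 ^+ absz k)%:C%C.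
Proof.
move=> /Re_norm_itv q1.
pose r := 1 + complex.Re `|z| + complex.Re `|z^-1|.
have [a0 b0] : 0 <= complex.Re `|z| /\ 0 <= complex.Re `|z^-1|.
  by rewrite -!ler0c -!normc_ReE.
have [|c c0 Hc] := @gauss_weight_le _ r q1; first by rewrite /r; lra.
exists c => // k; rewrite normrM normrX [`|q|]normc_ReE.
apply: (@le_trans _ _ (complex.Re `|q| ^+ (absz k ^ 2) * r ^+ absz k)%:C%C); last first.
  by rewrite lecR.
rewrite rmorphM rmorphXn /= ler_wpM2l ?exprn_ge0 -?normc_ReE//.
by apply: norm_exprz_le; rewrite normc_ReE lecR /r; lra.
Qed.

Lemma expr_norm_lt1 q n : `|q| < 1 -> q ^+ n.+1 != 1.
Proof.
move=> q1; apply/eqP => h.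
by have := exprn_ilt1 n.+1 (normr_ge0 q) q1; rewrite -normrX h normr1 ltxx.
Qed.

Lemma cvg_qpoch q : `|q| < 1 -> cvgn (qpoch q).
Proof.
move=> q1; apply: (@cvg_prod_geometric _ _ 1 (complex.Re `|q|)).
  exact: Re_norm_itv.
by move=> n; rewrite normrN normrX mul1r rmorphXn /= -normc_ReE.
Qed.

(** Each inverse factor is [1 + q^n / (1 - q^n)], and [|1 - q^n| >= 1 - |q|]. Convergence of the
    inverses is what shows that the infinite product is not 0. *)
Lemma cvg_qpochV q : `|q| < 1 -> cvgn (fun N => (qpoch q N)^-1).
Proof.
move=> q1; have /andP[rho0 rho1] := Re_norm_itv q1.
set rho := complex.Re `|q| in rho0 rho1.
have -> : (fun N => (qpoch q N)^-1) =
    fun N => \prod_(1 <= n < N.+1) (1 + q ^+ n / (1 - q ^+ n)).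
  apply/funext => N; rewrite /qpoch -prodfV; apply: eq_big_nat => -[//|n] _.
  have h : 1 - q ^+ n.+1 != 0 by rewrite subr_eq0 eq_sym expr_norm_lt1.
  by field.
apply: (@cvg_prod_geometric _ _ (1 - rho)^-1 rho); first by rewrite rho0.
(* At index 0 the denominator is 0, and with inverse 0 the bound still holds. *)
move=> [|n]; first by rewrite expr0 subrr invr0 mulr0 normr0 mulr1 ler0c invr_ge0; lra.
rewrite normrM normrX normrV ?unitfE; last by rewrite subr_eq0 eq_sym expr_norm_lt1.
rewrite rmorphM mulrC rmorphXn /= -normc_ReE ler_wpM2r ?exprn_ge0//.
have d0 : 0 < 1 - rho by lra.
have dC : (1 - rho)%:C%C = 1 - `|q| by rewrite rmorphB /= -normc_ReE.
rewrite fmorphV /= dC lef_pV2 ?posrE ?subr_gt0//.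
  apply: le_trans (lerB_dist _ _); rewrite normr1 lerD2l lerN2 normrX.
  by rewrite exprS ler_piMr// exprn_ile1// ltW.
by rewrite normr_gt0 subr_eq0 eq_sym expr_norm_lt1.
Qed.

Lemma bounded_cvgn (u : nat -> R[i]) : cvgn u -> exists2 M : R, 0 <= M &
  forall n, `|u n| <= M%:C%C.
Proof.
move=> /cvg_seq_bounded[M [Mr HM]].
have MM : M < `|M| + 1 by rewrite (le_lt_trans (real_ler_norm Mr))// ltrDl.
exists (complex.Re (`|M| + 1)).
  by rewrite -ler0c RRe_real ?addr_ge0// rpredD// ?normr_real.
have h : `|M| + 1 \is Num.real by rewrite rpredD ?normr_real ?rpred1.
by move=> n; rewrite RRe_real//; exact: (HM _ MM n I).
Qed.

Lemma qpoch_sq_nroot q : `|q| < 1 -> forall n, (q ^+ 2) ^+ n.+1 != 1.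
Proof. by move=> q1 n; apply: expr_norm_lt1; rewrite normrX exprn_ilt1. Qed.

Lemma cvg_jprod q z : `|q| < 1 -> cvgn (jprod q z).
Proof.
move=> q1; have rho01 := Re_norm_itv q1; have [rho0 rho1] := andP rho01.
suff H w : cvgn (fun N => \prod_(1 <= n < N.+1) (1 + w * q ^+ (2 * n - 1))).
  rewrite [jprod q z](_ : _ = fun N =>
    (\prod_(1 <= n < N.+1) (1 + z * q ^+ (2 * n - 1))) *
    (\prod_(1 <= n < N.+1) (1 + z^-1 * q ^+ (2 * n - 1)))).
    by apply: is_cvgM; exact: H.
  by apply/funext => N; rewrite /jprod big_split.
apply: (@cvg_prod_geometric _ _ (complex.Re `|w|) (complex.Re `|q|)) => // n.
rewrite normrM normrX rmorphM rmorphXn /= -!normc_ReE ler_wpM2l//.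
by apply: ler_wiXn2l; rewrite ?normr_ge0 ?(ltW q1)//; lia.
Qed.

Lemma cvgn_sub (u : nat -> R[i]) (l : R[i]) (f : nat -> nat) :
  (forall A, (\forall N \near \oo, (A <= f N)%N)%classic) ->
  (u n @[n --> \oo] --> l -> u (f n) @[n --> \oo] --> l)%classic.
Proof.
move=> fo ul; apply: (cvg_comp f u _ ul).
by apply/cvgnyPge => A; exact: fo.
Qed.

Lemma cvg_sum_tterm q z : `|q| < 1 -> q != 0 -> z != 0 ->
  (\sum_(k <- window N) tterm q z k @[N --> \oo]
     --> limn (qpoch (q ^+ 2)) * limn (jprod q z))%classic.
Proof.
move=> q1 q0 z0; set e := qpoch (q ^+ 2).
have qq1 : `|q ^+ 2| < 1 by rewrite normrX exprn_ilt1.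
have ce : cvgn e by exact: cvg_qpoch.
have ce' : cvgn (fun N => (e N)^-1) by exact: cvg_qpochV.
have e0 N : e N != 0 by apply: qpoch_neq0; exact: qpoch_sq_nroot.
pose l := limn e; pose l' := limn (fun N => (e N)^-1).
have ll' : l * l' = 1.
  have H : (e N * (e N)^-1 @[N --> \oo] --> l * l')%classic.
    by apply: cvgM; [exact: ce|exact: ce'].
  have H1 : (e N * (e N)^-1 @[N --> \oo] --> (1 : R[i]))%classic.
    by under eq_fun do rewrite divff//; exact: cvg_cst.
  by rewrite -(cvg_lim (@norm_hausdorff _ _) H) (cvg_lim (@norm_hausdorff _ _) H1).
(* [D N k] is the weight of [tterm q z k] in the finite triple product; it is
   bounded and tends to 1, so the series is reached by dominated convergence. *)
pose D N k := e N * e (2 * N)%N * ((e (absz (N%:Z + k)))^-1 * (e (absz (N%:Z - k)))^-1).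
have D1 k : (D N k @[N --> \oo] --> (1 : R[i]))%classic.
  have -> : nbhs (1 : R[i]) = nbhs (l * l * (l' * l')).
    by rewrite mulrACA ll' mulr1.
  apply: cvgM; apply: cvgM; first exact: ce.
  - apply: (cvgn_sub _ ce) => A; exists A => // N /= AN; lia.
  - apply: (@cvgn_sub (fun N => (e N)^-1) _ _ _ ce') => A.
    by exists (A + absz k)%N => // N /= AN; lia.
  - apply: (@cvgn_sub (fun N => (e N)^-1) _ _ _ ce') => A.
    by exists (A + absz k)%N => // N /= AN; lia.
have eP N : e N * jprod q z N = \sum_(k <- window N) tterm q z k * D N k.
  rewrite finite_jacobi//; last exact: qpoch_sq_nroot.
  rewrite sum_window mulr_sumr; apply: eq_big_nat => i /andP[_ iN].
  rewrite /D /qbin -ltnS iN.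
  have -> : absz (N%:Z + (i%:Z - N%:Z)) = i by lia.
  have -> : absz (N%:Z - (i%:Z - N%:Z))%R = (2 * N - i)%N by lia.
  by rewrite invfM -/e; ring.
have -> : (fun N => \sum_(k <- window N) tterm q z k) = fun N =>
    e N * jprod q z N - \sum_(k <- window N) tterm q z k * (D N k - 1).
  apply/funext => N; rewrite eP -sumrB; apply: eq_bigr => k _.
  by rewrite mulrBr mulr1 subKr.
rewrite -[_ * _]subr0; apply: cvgB.
  by apply: cvgM; [exact: ce|exact: cvg_jprod].
have [M M0 HM] := bounded_cvgn ce.
have [M' M'0 HM'] := bounded_cvgn ce'.
have [c c0 Hc] := tterm_le z q1.
(* [B] bounds [|D N k - 1|]: two factors of [D N k] are values of [e] and two are inverses of such
   values. *)
pose B := M * M * (M' * M') + 1.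
have B0 : 0 <= B by rewrite addr_ge0 ?mulr_ge0.
apply: (@cvg_dominated_sum _ _ (fun k => B * c * 2^-1 ^+ absz k)).
- by apply: summable_seqZ; [rewrite mulr_ge0|exact: summable_geometric_int].
- by move=> N; have [uW _] := exhausting_window; exact: uW.
- move=> N k; rewrite mulrC -mulrA normrM rmorphM /= ler_pM//.
  apply: le_trans (ler_normB _ _) _.
  rewrite normr1 /B rmorphD /= lerD2r !normrM !rmorphM /=.
  by rewrite !ler_pM ?mulr_ge0//; first [exact: HM|exact: HM'].
move=> k; have -> : nbhs (0 : R[i]) = nbhs (tterm q z k * (1 - 1)).
  by rewrite subrr mulr0.
apply: cvgM; first exact: cvg_cst.
exact: (cvgB (D1 k) (cvg_cst (1 : R[i]))).
Qed.

(** The series [T(q, z)], defined by symmetric partial sums; [cvg_jtheta_exhausting] permits any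
    other order. *)
Definition jtheta q z : R[i] := limn (fun N => \sum_(k <- window N) tterm q z k).

Lemma jthetaE q z : `|q| < 1 -> q != 0 -> z != 0 ->
  jtheta q z = limn (qpoch (q ^+ 2)) * limn (jprod q z).
Proof.
by move=> q1 q0 z0; apply: (cvg_lim (@norm_hausdorff _ _)); exact: cvg_sum_tterm.
Qed.

Lemma cvg_jtheta q z : `|q| < 1 -> q != 0 -> z != 0 ->
  (\sum_(k <- window N) tterm q z k @[N --> \oo] --> jtheta q z)%classic.
Proof. by move=> q1 q0 z0; rewrite jthetaE//; exact: cvg_sum_tterm. Qed.

End Jacobi.

(** * Identities between theta series *)

Section JacobiTheta.
Context {R : realType}.
Implicit Types (q z w : R[i]) (N : nat) (k : int).

Lemma tterm_exprz q z k : tterm q z k = q ^ (k * k) * z ^ k.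
Proof.
rewrite /tterm exprnP; congr (q ^ _ * _).
by rewrite -mulnn PoszM; case: k => n //; rewrite NegzE abszN mulrNN.
Qed.

Lemma cvg_jtheta_exhausting q z (S : nat -> seq int) :
  `|q| < 1 -> q != 0 -> z != 0 -> exhausting S ->
  (\sum_(k <- S N) tterm q z k @[N --> \oo] --> jtheta q z)%classic.
Proof.
move=> q1 q0 z0 xS; have [c c0 Hc] := tterm_le z q1.
have sG := summable_seqZ c0 (@summable_geometric_int R).
by apply: (cvg_exhausting_sum sG Hc exhausting_window xS); exact: cvg_jtheta.
Qed.

Lemma jthetaV q z : `|q| < 1 -> q != 0 -> z != 0 -> jtheta q z^-1 = jtheta q z.
Proof.
move=> q1 q0 z0; apply: (cvg_lim (@norm_hausdorff _ _)).
have xS := exhausting_map (@opprK int) (@opprK int) exhausting_window.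
have := cvg_jtheta_exhausting q1 q0 z0 xS.
under eq_fun do rewrite big_map.
apply: cvg_trans; apply: near_eq_cvg; near=> N.
apply: eq_bigr => k _; rewrite /tterm abszN; congr (_ * _).
by rewrite exprz_inv.
Unshelve. all: by end_near.
Qed.

(** Reindexing by [k - 1] and completing the square: [1 + 2 (k - 1) + (k - 1)^2 = k^2]. *)
Lemma jtheta_shift q z : `|q| < 1 -> q != 0 -> z != 0 ->
  q * z * jtheta q (q ^+ 2 * z) = jtheta q z.
Proof.
move=> q1 q0 z0; apply/esym; apply: (cvg_lim (@norm_hausdorff _ _)).
have xS := exhausting_map (addrK (-1 : int)) (addrNK (-1 : int)) exhausting_window.
have qz0 : q ^+ 2 * z != 0 by rewrite mulf_neq0 ?expf_neq0.
have H := cvgM (@cvg_cst R[i] (q * z) nat eventually _)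
  (cvg_jtheta_exhausting q1 q0 qz0 xS).
have E N : \sum_(k <- window N) tterm q z k =
    q * z * \sum_(k <- [seq k - 1 | k <- window N]) tterm q (q ^+ 2 * z) k.
  rewrite [in RHS]big_map mulr_sumr; apply: eq_bigr => k _.
  rewrite !tterm_exprz exprzMl ?unitfE ?expf_neq0// exprnP exprz_exp.
  transitivity (q ^ (1 + (k - 1) * (k - 1) + 2%:Z * (k - 1)) * z ^ (1 + (k - 1))).
    have -> : 1 + (k - 1) * (k - 1) + 2%:Z * (k - 1) = k * k by ring.
    by rewrite addrC subrK.
  by rewrite !expfzDr// !expr1z; ring.
by under eq_fun do rewrite E; exact: H.
Qed.

(** The exponents of [q] match because [(j + k)^2 + (j - k)^2 = 2 j^2 + 2 k^2]; in the odd case the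
    extra 1 contributes the linear terms and the factor [q z]. *)
Lemma tterm_mul_even q z w j k : q != 0 -> z != 0 -> w != 0 ->
  tterm q z (j + k) * tterm q w (j - k) =
  tterm (q ^+ 2) (z * w) j * tterm (q ^+ 2) (z / w) k.
Proof.
move=> q0 z0 w0; rewrite !tterm_exprz.
transitivity (q ^ (2%:Z * (j * j) + 2%:Z * (k * k)) * z ^ (j + k) * w ^ (j - k)).
  have -> : 2%:Z * (j * j) + 2%:Z * (k * k)
          = (j + k) * (j + k) + (j - k) * (j - k) by ring.
  by rewrite [q ^ (_ + _)]expfzDr//; ring.
rewrite !exprnP !exprz_exp !exprzMl ?unitfE ?invr_eq0// exprz_inv !expfzDr//; ring.
Qed.

Lemma tterm_mul_odd q z w j k : q != 0 -> z != 0 -> w != 0 ->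
  tterm q z (j + k + 1) * tterm q w (j - k) =
  q * z * (tterm (q ^+ 2) (q ^+ 2 * (z * w)) j * tterm (q ^+ 2) (q ^+ 2 * (z / w)) k).
Proof.
move=> q0 z0 w0; rewrite !tterm_exprz.
transitivity (q ^ (1 + j * j + j * j + j + j + k * k + k * k + k + k)
  * z ^ (j + k + 1) * w ^ (j - k)).
  have -> : 1 + j * j + j * j + j + j + k * k + k * k + k + k
          = (j + k + 1) * (j + k + 1) + (j - k) * (j - k) by ring.
  by rewrite [q ^ (_ + _)]expfzDr//; ring.
rewrite !exprzMl ?unitfE ?mulf_neq0 ?invr_eq0 ?expfz_neq0//.
rewrite exprz_inv !expfzDr// !expr1z; ring.
Qed.

Lemma jtheta_mul q z w : `|q| < 1 -> q != 0 -> z != 0 -> w != 0 ->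
  jtheta q z * jtheta q w =
    jtheta (q ^+ 2) (z * w) * jtheta (q ^+ 2) (z / w)
    + q * z * (jtheta (q ^+ 2) (q ^+ 2 * (z * w)) * jtheta (q ^+ 2) (q ^+ 2 * (z / w))).
Proof.
move=> q1 q0 z0 w0.
have [c c0 Hc] := tterm_le z q1.
have [d d0 Hd] := tterm_le w q1.
have sG := summable_seqZ c0 (@summable_geometric_int R).
have sH := summable_seqZ d0 (@summable_geometric_int R).
have xW := @exhausting_window.
pose f (p : int * int) := tterm q z p.1 * tterm q w p.2.
pose S N := [seq (i, j) | i <- window N, j <- window N].
have xS : exhausting S by exact: exhausting_allpairs.
have fS : (\sum_(p <- S N) f p @[N --> \oo] --> jtheta q z * jtheta q w)%classic.
  have E N : \sum_(p <- S N) f p =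
      (\sum_(k <- window N) tterm q z k) * \sum_(k <- window N) tterm q w k.
    by rewrite big_allpairs mulr_suml; apply: eq_bigr => i _; rewrite mulr_sumr.
  have H := cvgM (cvg_jtheta q1 q0 z0) (cvg_jtheta q1 q0 w0).
  by under eq_fun do rewrite E; exact: H.
(* [phi 0] and [phi 1] parametrize the pairs [(m, n)] with [m + n] even and odd. *)
pose phi (s : int) (p : int * int) := (p.1 + p.2 + s, p.1 - p.2).
pose S' N := map (phi 0) (S N) ++ map (phi 1) (S N).
have xS' : exhausting S'.
  have [uS inS] := xS; split=> [N|[m n]].
    have phi_inj s : injective (phi s) by move=> [a b] [a' b'] [] /= ? ?; congr pair; lia.
    rewrite cat_uniq !map_inj_uniq// !uS andbT; apply/hasPn => _ /mapP[[a b] _ ->].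
    by apply/negP => /mapP[[a' b'] _ [] /= ? ?]; lia.
  (* For either parity the preimage of [(m, n)] is [(a, a - n)], with [a] the integer quotient of
     [m + n] by 2. *)
  have [[a ab]|[a ab]] : (exists a, m + n = a * 2) \/ (exists a, m + n = a * 2 + 1).
  - have : ((m + n) %% 2 = 0)%Z \/ ((m + n) %% 2 = 1)%Z by lia.
    by move=> [] h; [left|right]; exists ((m + n) %/ 2)%Z; lia.
  - near=> N; rewrite mem_cat; apply/orP; left; apply/mapP.
    exists (a, a - n); first by near: N; exact: inS.
    by rewrite /phi /=; congr pair; lia.
  - near=> N; rewrite mem_cat; apply/orP; right; apply/mapP.
    exists (a, a - n); first by near: N; exact: inS.
    by rewrite /phi /=; congr pair; lia.
have fG p : `|f p| <= (c * 2^-1 ^+ absz p.1 * (d * 2^-1 ^+ absz p.2))%:C%C.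
  by rewrite normrM rmorphM /= ler_pM.
have fS' := cvg_exhausting_sum (summable_seq_prod sG sH) fG xS xS' fS.
have zw0 : z * w != 0 by rewrite mulf_neq0.
have zVw0 : z / w != 0 by rewrite mulf_neq0 ?invr_eq0.
have qq1 : `|q ^+ 2| < 1 by rewrite normrX exprn_ilt1.
have qq0 : q ^+ 2 != 0 by rewrite expf_neq0.
have qzw0 : q ^+ 2 * (z * w) != 0 by rewrite mulf_neq0.
have qzVw0 : q ^+ 2 * (z / w) != 0 by rewrite mulf_neq0.
apply: (etrans (esym (cvg_lim (@norm_hausdorff _ _) fS'))).
apply: (cvg_lim (@norm_hausdorff _ _)).
have H := cvgD (cvgM (cvg_jtheta qq1 qq0 zw0) (cvg_jtheta qq1 qq0 zVw0))
  (cvgM (@cvg_cst R[i] (q * z) nat eventually _)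
    (cvgM (cvg_jtheta qq1 qq0 qzw0) (cvg_jtheta qq1 qq0 qzVw0))).
have -> : (fun N => \sum_(p <- S' N) f p) = fun N =>
    (\sum_(k <- window N) tterm (q ^+ 2) (z * w) k) *
      (\sum_(k <- window N) tterm (q ^+ 2) (z / w) k)
    + q * z * ((\sum_(k <- window N) tterm (q ^+ 2) (q ^+ 2 * (z * w)) k) *
      (\sum_(k <- window N) tterm (q ^+ 2) (q ^+ 2 * (z / w)) k)); last exact: H.
apply/funext => N.
rewrite big_cat ![\sum_(i <- map (phi _) _) _]big_map !big_allpairs /=.
congr (_ + _).
  rewrite mulr_suml; apply: eq_bigr => j _; rewrite mulr_sumr.
  by apply: eq_bigr => k _; rewrite /f /phi /= addr0 tterm_mul_even.
rewrite mulr_suml mulr_sumr; apply: eq_bigr => j _; rewrite !mulr_sumr.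
by apply: eq_bigr => k _; rewrite /f /phi /= tterm_mul_odd.
Unshelve. all: by end_near.
Qed.

End JacobiTheta.

(** * Theta functions as theta series *)

Section ThetaJacobi.
Context {R : realType}.
Implicit Types (u t z w : R[i]).

Lemma expCD z w : expC (z + w) = expC z * expC w.
Proof.
case: z w => [a b] [c d]; rewrite /expC /= expRD cosD sinD.
apply/eqP; rewrite eq_complex /=; apply/andP; split; apply/eqP; ring.
Qed.

Lemma expC0 : expC (0 : R[i]) = 1.
Proof. by rewrite /expC /= expR0 cos0 sin0 mulr1 mulr0. Qed.

Lemma expCNK z : expC (- z) * expC z = 1.
Proof. by rewrite -expCD addNr expC0. Qed.

Lemma expC_neq0 z : expC z != 0.
Proof. by apply/eqP => h; have := expCNK z; rewrite h mulr0 => /esym/eqP; rewrite oner_eq0. Qed.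

Lemma expCN z : expC (- z) = (expC z)^-1.
Proof. by apply: (mulIf (expC_neq0 z)); rewrite expCNK mulVf ?expC_neq0. Qed.

Lemma norm_expC z : `|expC z| = (expR (complex.Re z))%:C%C.
Proof.
by rewrite normc_def /= !exprMn -mulrDr cos2Dsin2 mulr1 sqrtr_sqr ger0_norm.
Qed.

Lemma expC_realMi (x : R) : expC (x%:C%C * 'i) = (cos x +i* sin x)%C.
Proof.
rewrite -complexiE /expC /= !(mulr0, mul0r, mulr1, subr0, addr0, add0r, oppr0).
by rewrite expR0 !mul1r.
Qed.

Lemma expC_pii2 : expC (piC R * 'i / 2) = 'i.
Proof.
have -> : piC R * 'i / 2 = (pi / 2)%:C%C * 'i.
  by rewrite rmorphM fmorphV rmorph_nat /= mulrAC.
by rewrite expC_realMi cos_pihalf sin_pihalf -complexiE.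
Qed.

(** A square root of [nome t], the [q] of the theta series. Likewise [zexp u] is the half-angle
    exponential, whose square is the variable of the series. *)
Definition hnome t : R[i] := expC (piC R * 'i * t).
Definition zexp u : R[i] := expC (piC R * 'i * u).

Lemma hnome_neq0 t : hnome t != 0. Proof. exact: expC_neq0. Qed.
Lemma zexp_neq0 u : zexp u != 0. Proof. exact: expC_neq0. Qed.

Lemma nomeE t : nome t = hnome t ^+ 2.
Proof. by rewrite /nome /hnome expr2 -expCD; congr expC; ring. Qed.

Lemma hnome_half t : hnome (t / 2) ^+ 2 = hnome t.
Proof. by rewrite /hnome expr2 -expCD; congr expC; field. Qed.

Lemma hnome_lt1 t : 0 < complex.Im t -> `|hnome t| < 1.
Proof.
move=> t0; rewrite norm_expC -[1]/((1 : R)%:C%C) ltcR -expR0 ltr_expR.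
rewrite /piC -complexiE; case: t t0 => a b /= b0.
rewrite !(mulr0, mul0r, mulr1, subr0, addr0, add0r, sub0r, oppr0) oppr_lt0.
by rewrite mulr_gt0// pi_gt0.
Qed.

Lemma zexpD u w : zexp (u + w) = zexp u * zexp w.
Proof. by rewrite /zexp mulrDr expCD. Qed.

Lemma zexpN u : zexp (- u) = (zexp u)^-1.
Proof. by rewrite /zexp mulrN expCN. Qed.

Lemma cvg_exprC (p : R[i]) : `|p| < 1 -> (p ^+ N @[N --> \oo] --> (0 : R[i]))%classic.
Proof.
move=> /Re_norm_itv /andP[r0 r1]; apply: cvgC_norm0 => e e0.
have : (complex.Re `|p| ^+ n @[n --> \oo] --> (0 : R))%classic.
  by apply: cvg_expr; rewrite ger0_norm.
move=> /cvgr0Pnorm_le /(_ _ e0); apply: filterS => n.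
by rewrite ger0_norm ?exprn_ge0// -lecR rmorphXn /= -normc_ReE -normrX.
Qed.

Lemma cvg_theta_prod (p z : R[i]) : `|p| < 1 ->
  cvgn (fun N => \prod_(1 <= n < N.+1) ((1 - p ^+ n * z) * (1 - p ^+ n * z^-1))).
Proof.
move=> p1.
suff H w : cvgn (fun N => \prod_(1 <= n < N.+1) (1 - p ^+ n * w)).
  under eq_fun do rewrite big_split /=.
  by apply: is_cvgM; exact: H.
apply: (@cvg_prod_geometric _ _ (complex.Re `|w|) (complex.Re `|p|)).
  exact: Re_norm_itv.
by move=> n; rewrite normrN normrM normrX rmorphM rmorphXn /= -!normc_ReE mulrC.
Qed.

Lemma theta1E u t : 0 < complex.Im t ->
  theta1 u t = - 'i * expC (piC R * 'i * t / 4) * zexp u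
    * jtheta (hnome t) (- (hnome t * zexp u ^+ 2)).
Proof.
move=> t0; have q1 := hnome_lt1 t0; set q := hnome t.
set e := zexp u; have e0 : e != 0 by exact: zexp_neq0.
have q0 : q != 0 by exact: hnome_neq0.
have qq1 : `|q ^+ 2| < 1 by rewrite normrX exprn_ilt1.
rewrite jthetaE//; last by rewrite oppr_eq0 mulf_neq0 ?expf_neq0.
pose Q N := \prod_(1 <= n < N.+1)
  ((1 - (q ^+ 2) ^+ n * e ^+ 2) * (1 - (q ^+ 2) ^+ n * (e ^+ 2)^-1)).
(* The triple product at [- q e^2] differs from the product in [theta1] by a
   shift of the index of half of its factors. *)
have jQ N : jprod q (- (q * e ^+ 2)) N * (1 - (e ^+ 2)^-1 * (q ^+ 2) ^+ N) =
    (1 - (e ^+ 2)^-1) * Q N.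
  elim: N => [|N IH]; first by rewrite /jprod /Q !big_geq// !mulr1 mul1r.
  rewrite /Q big_nat_recr//= -/(Q N) [RHS]mulrA -IH /jprod big_nat_recr//= -/(jprod _ _ N).
  have -> : (2 * N.+1 - 1 = (2 * N).+1)%N by lia.
  rewrite !(exprS _ N) (exprS _ (2 * N)) exprM; move: (_ ^+ N) => a.
  by field; rewrite q0 e0.
have cQ : cvgn Q by exact: cvg_theta_prod.
have limQ : limn (jprod q (- (q * e ^+ 2))) = (1 - (e ^+ 2)^-1) * limn Q.
  have H1 : (jprod q (- (q * e ^+ 2)) N * (1 - (e ^+ 2)^-1 * (q ^+ 2) ^+ N)
      @[N --> \oo] --> limn (jprod q (- (q * e ^+ 2))) * (1 - (e ^+ 2)^-1 * 0))%classic.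
    apply: cvgM; first exact: cvg_jprod.
    apply: cvgB; first exact: cvg_cst.
    by apply: cvgM; [exact: cvg_cst|exact: cvg_exprC].
  have H2 : ((1 - (e ^+ 2)^-1) * Q N @[N --> \oo] --> (1 - (e ^+ 2)^-1) * limn Q)%classic.
    by apply: cvgM; [exact: cvg_cst|exact: cQ].
  have := cvg_lim (@norm_hausdorff _ _) H1.
  rewrite mulr0 subr0 mulr1 => <-.
  rewrite -(cvg_lim (@norm_hausdorff _ _) H2); congr (limn _).
  by apply/funext => N; exact: jQ.
rewrite limQ /theta1 /prodinf nomeE -/q.
have -> : (fun N => \prod_(1 <= n < N.+1)
    (1 - 2 * (q ^+ 2) ^+ n * cosC (2 * piC R * u) + (q ^+ 2) ^+ (2 * n))) = Q.
  apply/funext => N; apply: eq_bigr => n _.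
  rewrite /cosC expCN.
  have -> : expC ('i * (2 * piC R * u)) = e ^+ 2.
    by rewrite /e /zexp expr2 -expCD; congr expC; ring.
  rewrite mulnC exprM; move: (_ ^+ n) => a.
  by field.
rewrite -/(qpoch (q ^+ 2)).
(* The factor [1 - (e ^+ 2)^-1] left over from the triple product is, times [e], the numerator of
   the sine. *)
have -> : sinC (piC R * u) = (e - e^-1) / (2 * 'i).
  have iE : 'i * (piC R * u) = piC R * 'i * u by ring.
  by rewrite /sinC iE expCN.
have -> : 2 * piC R * 'i * t / 8 = piC R * 'i * t / 4 by field.
have i2 : 'i * 'i = -1 :> R[i] by rewrite -expr2 sqrCi.
have -> : - 'i = 'i^-1 :> R[i].
  by apply: (mulfI (neq0Ci R[i])); rewrite mulrN i2 opprK divff ?neq0Ci.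
have := neq0Ci R[i]; move: ('i) => i' i'0.
by field; rewrite i'0 e0.
Qed.

End ThetaJacobi.

(** * Weierstrass' three-term identity *)

Section BilinearTheta.
Variable F : fieldType.
Hypothesis two_neq0 : (2 : F) != 0.

(** At [z = - q (X Y)^2] and [w = - q (X / Y)^2] one has [z w = q^2 X^4] and [z / w = Y^4], so [X]
    and [Y] separate. The shift rule then reduces [K (q^4 X^4)] to [K (X^4)], leaving a 2 x 2
    minor. *)
Lemma shifted_mul_bilinear (J K : F -> F) (q X Y : F) :
  q != 0 -> X != 0 -> Y != 0 ->
  (forall z w, z != 0 -> w != 0 -> J z * J w =
     K (z * w) * K (z / w) + q * z * (K (q ^+ 2 * (z * w)) * K (q ^+ 2 * (z / w)))) ->
  (forall z, z != 0 -> q ^+ 2 * z * K ((q ^+ 2) ^+ 2 * z) = K z) ->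
  X * Y * (X * Y^-1) * (J (q * - (X * Y) ^+ 2) * J (q * - (X * Y^-1) ^+ 2)) =
  X ^+ 2 * K (q ^+ 2 * X ^+ 4) * K (Y ^+ 4) - K (X ^+ 4) * (Y ^+ 2 * K (q ^+ 2 * Y ^+ 4)).
Proof.
move=> q0 X0 Y0 Jmul Kshift.
have nz Z : Z != 0 -> q * - Z ^+ 2 != 0.
  by move=> Z0; rewrite mulf_neq0 ?oppr_eq0 ?expf_neq0.
rewrite Jmul ?nz ?mulf_neq0 ?invr_eq0//.
have -> : q * - (X * Y) ^+ 2 * (q * - (X / Y) ^+ 2) = q ^+ 2 * X ^+ 4 by field.
have -> : q * - (X * Y) ^+ 2 / (q * - (X / Y) ^+ 2) = Y ^+ 4.
  by field; rewrite Y0 q0 oppr_eq0 expf_neq0.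
rewrite -(Kshift (X ^+ 4)) ?expf_neq0//.
have -> : (q ^+ 2) ^+ 2 * X ^+ 4 = q ^+ 2 * (q ^+ 2 * X ^+ 4) by ring.
by field.
Qed.

Variables (T A B : F -> F) (c : F).
Hypothesis T_mul : forall x y, T (x + y) * T (x - y) = c * (B x * A y - A x * B y).

(* The minors [B x * A y - A x * B y] satisfy the three-term Pluecker relation. *)
Lemma weierstrass_three_term z h w :
  T (z + h + w) * T (z - h) * (T h * T (w - h))
  + T (z - h + w) * T (z + h) * (T (h + w) * T h)
  = T w * T (2 * h) * (T z * T (z + w)).
Proof.
have E x y u v : x = u + v -> y = u - v -> T x * T y = c * (B u * A v - A u * B v).
  by move=> -> ->; exact: T_mul.
rewrite (E (z + h + w) (z - h) (z + w / 2) (h + w / 2)); [|by field|by field].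
rewrite (E h (w - h) (w / 2) (h - w / 2)); [|by field|by field].
rewrite [T (z - h + w) * _]mulrC.
rewrite (E (z + h) (z - h + w) (z + w / 2) (h - w / 2)); [|by field|by field].
rewrite (E (h + w) h (h + w / 2) (w / 2)); [|by field|by field].
rewrite [T w * _]mulrC (E (2 * h) w (h + w / 2) (h - w / 2)); [|by field|by field].
rewrite [T z * _]mulrC (E (z + w) z (z + w / 2) (w / 2)); [|by field|by field].
by ring.
Qed.

(** Here [f] is [T] translated by a half period [w], up to an exponential factor. Evenness replaces
    [f h] by [f (- h)] in the first term, which produces the [T (w - h)] of the three-term identity;
    the exponential factors collect to [g z]. *)
Lemma even_translate_sum (f g : F -> F) (k w : F) :
  (forall u v, g (u + v) = g u * g v) ->
  (forall u, f u = k * g u * T (u + w)) -> (forall u, f (- u) = f u) ->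
  forall z h,
    (f (z + h) * T (z - h) + f (z - h) * T (z + h)) * (f h * T h)
    = f 0 * T (2 * h) * (T z * f z).
Proof.
move=> gD fE fN z h.
have gzh : g (z + h) * g (- h) = g z by rewrite -gD addrK.
have gzh' : g (z - h) * g h = g z by rewrite -gD subrK.
have g0 : g 0 * g z = g z by rewrite -gD add0r.
transitivity (k ^+ 2 * g z *
  (T (z + h + w) * T (z - h) * (T h * T (w - h))
  + T (z - h + w) * T (z + h) * (T (h + w) * T h))).
  rewrite mulrDr mulrDl; congr (_ + _).
    by rewrite -(fN h) !fE -gzh (addrC (- h) w); ring.
  by rewrite !fE -gzh'; ring.
by rewrite weierstrass_three_term !fE add0r -{1}g0; ring.
Qed.

End BilinearTheta.

(** * Series, parity and translate sums of the four theta functions *)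

Section ThetaIdentities.
Context {R : realType}.
Variable t : R[i].
Hypothesis t_gt0 : 0 < complex.Im t.
Implicit Types (x y z h u w : R[i]).

Local Notation q := (hnome t).
Local Notation a := (zexp (t / 4)).
Let q1 : `|q| < 1. Proof. exact: hnome_lt1. Qed.
Let q0 : q != 0. Proof. exact: hnome_neq0. Qed.

Lemma zexp_half_period : zexp (t / 2) = a ^+ 2.
Proof. by rewrite expr2 -zexpD; congr zexp; field. Qed.

Lemma hnome_quarter : q = a ^+ 4.
Proof.
by rewrite (exprM a 2 2) -zexp_half_period expr2 -zexpD; congr zexp; field.
Qed.

Lemma zexp_half : zexp (1 / 2) = 'i :> R[i].
Proof. by rewrite -expC_pii2 /zexp; congr expC; field. Qed.

Lemma expC_quarter u : expC (piC R * 'i * (u + t / 4)) = zexp u * a.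
Proof. by rewrite -zexpD. Qed.

Let i2 : 'i ^+ 2 = -1 :> R[i]. Proof. exact: sqrCi. Qed.

Lemma theta1J u : theta1 u t = - 'i * a * zexp u * jtheta q (q * - zexp u ^+ 2).
Proof.
have aE : a = expC (piC R * 'i * t / 4) by congr expC; rewrite mulrA.
by rewrite aE mulrN (theta1E u t_gt0).
Qed.

Let ii_factor (b e J : R[i]) : - 'i * b * (e * 'i) * J = b * e * J.
Proof.
transitivity (- ('i ^+ 2) * (b * e) * J); first by ring.
by rewrite i2; ring.
Qed.

Lemma theta2J u : theta2 u t = a * zexp u * jtheta q (q * zexp u ^+ 2).
Proof. by rewrite /theta2 theta1J zexpD zexp_half exprMn i2 mulrN1 opprK ii_factor. Qed.

Let zexpX2_neq0 u : zexp u ^+ 2 != 0.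
Proof. by rewrite expf_neq0// zexp_neq0. Qed.

Let opp_zexpX2_neq0 u : - zexp u ^+ 2 != 0.
Proof. by rewrite oppr_eq0. Qed.

Lemma theta3J u : theta3 u t = jtheta q (zexp u ^+ 2).
Proof.
rewrite /theta3 expC_quarter.
have -> : (t + 1) / 2 = t / 2 + 1 / 2 :> R[i] by rewrite mulrDl.
rewrite theta1J addrA !zexpD zexp_half zexp_half_period ii_factor.
have -> : q * - (zexp u * a ^+ 2 * 'i) ^+ 2 = q ^+ 2 * zexp u ^+ 2.
  by rewrite !exprMn i2 hnome_quarter; ring.
rewrite -(jtheta_shift q1 q0 (zexpX2_neq0 u)); move: (jtheta _ _) => J.
by rewrite hnome_quarter; ring.
Qed.

Lemma theta0J u : theta0 u t = jtheta q (- zexp u ^+ 2).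
Proof.
rewrite /theta0 -mulrA expC_quarter theta1J !zexpD zexp_half_period.
have -> : q * - (zexp u * a ^+ 2) ^+ 2 = q ^+ 2 * - zexp u ^+ 2.
  by rewrite !exprMn hnome_quarter; ring.
rewrite -(jtheta_shift q1 q0 (opp_zexpX2_neq0 u)); move: (jtheta _ _) => J.
rewrite hnome_quarter.
transitivity ('i ^+ 2 * (a ^+ 4 * zexp u ^+ 2) * J); first by ring.
by rewrite i2; ring.
Qed.

(** Inversion composed with the shift: [q / w] is the inverse of [w / q], and [q^2 (w / q) = q w].
    This gives the parity of [theta1] and [theta2], whose series have argument [- q z] or [q z]. *)
Lemma jtheta_reflect w : w != 0 -> jtheta q (q * w^-1) = w * jtheta q (q * w).
Proof.
move=> w0; have wq0 : w / q != 0 by rewrite mulf_neq0 ?invr_eq0.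
have -> : q * w^-1 = (w / q)^-1 by rewrite invfM invrK mulrC.
rewrite (jthetaV q1 q0 wq0) -(jtheta_shift q1 q0 wq0).
have -> : q ^+ 2 * (w / q) = q * w by field.
by congr (_ * _); rewrite mulrC divfK.
Qed.

Lemma theta0N u : theta0 (- u) t = theta0 u t.
Proof.
by rewrite !theta0J zexpN exprVn -invrN (jthetaV q1 q0 (opp_zexpX2_neq0 u)).
Qed.

Lemma theta3N u : theta3 (- u) t = theta3 u t.
Proof. by rewrite !theta3J zexpN exprVn (jthetaV q1 q0 (zexpX2_neq0 u)). Qed.

Lemma theta2N u : theta2 (- u) t = theta2 u t.
Proof.
have e0 := zexp_neq0 u.
rewrite !theta2J zexpN exprVn (jtheta_reflect (zexpX2_neq0 u)).
by move: (jtheta _ _) => J; field.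
Qed.

Lemma theta1N u : theta1 (- u) t = - theta1 u t.
Proof.
have e0 := zexp_neq0 u.
rewrite !theta1J zexpN exprVn -invrN (jtheta_reflect (opp_zexpX2_neq0 u)).
by move: (jtheta _ _) => J; field.
Qed.

(** Up to constants, the witnesses [A x] and [B x] are [theta_3 (2 x | 2 t)] and
    [theta_2 (2 x | 2 t)]. *)
Lemma theta1_mul_bilinear : exists A B c, forall x y,
  theta1 (x + y) t * theta1 (x - y) t = c * (B x * A y - A x * B y).
Proof.
exists (fun x => jtheta (q ^+ 2) (zexp x ^+ 4)).
exists (fun x => zexp x ^+ 2 * jtheta (q ^+ 2) (q ^+ 2 * zexp x ^+ 4)).
exists (- a ^+ 2) => x y.
have iaM (e1 e2 J1 J2 : R[i]) : (- 'i * a * e1 * J1) * (- 'i * a * e2 * J2)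
    = - a ^+ 2 * (e1 * e2 * (J1 * J2)).
  by rewrite -[- a ^+ 2]mulN1r -i2; ring.
transitivity (- a ^+ 2 * (zexp (x + y) * zexp (x - y) *
    (jtheta q (q * - zexp (x + y) ^+ 2) * jtheta q (q * - zexp (x - y) ^+ 2)))).
  by rewrite !theta1J; exact: iaM.
congr (_ * _); rewrite !zexpD zexpN.
apply: (shifted_mul_bilinear (J := jtheta q) (K := jtheta (q ^+ 2)) q0
  (zexp_neq0 x) (zexp_neq0 y)).
  by move=> z w z0 w0; exact: jtheta_mul.
have qq1 : `|q ^+ 2| < 1 by rewrite normrX exprn_ilt1.
have qq0 : q ^+ 2 != 0 by rewrite expf_neq0.
by move=> z z0; exact: (jtheta_shift qq1 qq0 z0).
Qed.

Let two_neq0 : (2 : R[i]) != 0. Proof. by rewrite pnatr_eq0. Qed.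

Lemma theta2_translate_sum z h :
  (theta2 (z + h) t * theta1 (z - h) t + theta2 (z - h) t * theta1 (z + h) t)
    * (theta2 h t * theta1 h t)
  = theta2 0 t * theta1 (2 * h) t * (theta1 z t * theta2 z t).
Proof.
have [A [B [c H]]] := theta1_mul_bilinear.
apply: (even_translate_sum two_neq0 (T := fun u => theta1 u t) H
  (f := fun u => theta2 u t) (g := fun=> 1) (k := 1) (w := 1 / 2)).
- by move=> *; rewrite mulr1.
- by move=> u; rewrite mulr1; exact: esym (mul1r _).
- exact: theta2N.
Qed.

Lemma theta0_translate_sum z h :
  (theta0 (z + h) t * theta1 (z - h) t + theta0 (z - h) t * theta1 (z + h) t)
    * (theta0 h t * theta1 h t)
  = theta0 0 t * theta1 (2 * h) t * (theta1 z t * theta0 z t).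
Proof.
have [A [B [c H]]] := theta1_mul_bilinear.
apply: (even_translate_sum two_neq0 (T := fun u => theta1 u t) H
  (f := fun u => theta0 u t) (g := zexp) (k := - 'i * a) (w := t / 2)).
- exact: zexpD.
- by move=> u; rewrite /theta0 expC_quarter; congr (_ * _); ring.
- exact: theta0N.
Qed.

Lemma theta3_translate_sum z h :
  (theta3 (z + h) t * theta1 (z - h) t + theta3 (z - h) t * theta1 (z + h) t)
    * (theta3 h t * theta1 h t)
  = theta3 0 t * theta1 (2 * h) t * (theta1 z t * theta3 z t).
Proof.
have [A [B [c H]]] := theta1_mul_bilinear.
apply: (even_translate_sum two_neq0 (T := fun u => theta1 u t) H
  (f := fun u => theta3 u t) (g := zexp) (k := a) (w := (t + 1) / 2)).
- exact: zexpD.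
- by move=> u; rewrite /theta3 expC_quarter; congr (_ * _); ring.
- exact: theta3N.
Qed.

End ThetaIdentities.

(** * Products of theta functions at half the modulus *)

Section HalfModulus.
Context {R : realType}.
Variable t : R[i].
Hypothesis t_gt0 : 0 < complex.Im t.
Implicit Types (x y : R[i]).

Let t2_gt0 : 0 < complex.Im (t / 2).
Proof.
have ImD (z w : R[i]) : complex.Im (z + w) = complex.Im z + complex.Im w.
  by case: z w => [? ?] [].
have := t_gt0; rewrite {1}(splitr t) ImD; move: (complex.Im _) => r; lra.
Qed.

Let q1 : `|hnome (t / 2)| < 1. Proof. exact: hnome_lt1. Qed.
Let q0 : hnome (t / 2) != 0. Proof. exact: hnome_neq0. Qed.

Let z0 x : zexp x ^+ 2 != 0.
Proof. by rewrite expf_neq0// zexp_neq0. Qed.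

Let oz0 x : - zexp x ^+ 2 != 0.
Proof. by rewrite oppr_eq0. Qed.

Let hnome_half_quarter : hnome (t / 2) = zexp (t / 4) ^+ 2.
Proof. by rewrite -zexp_half_period. Qed.

(** The square of [hnome (t / 2)] is [hnome t], so [jtheta_mul] leads from modulus [t / 2] to
    modulus [t]. Its even part is the [theta3] product and its odd part the [theta2] product. *)
Lemma theta3_half_mul x y : theta3 x (t / 2) * theta3 y (t / 2) =
  theta3 (x + y) t * theta3 (x - y) t + theta2 (x + y) t * theta2 (x - y) t.
Proof.
have [x0 y0] := (zexp_neq0 x, zexp_neq0 y).
rewrite !(theta3J t2_gt0) (jtheta_mul q1 q0 (z0 x) (z0 y)) hnome_half.
rewrite !(theta3J t_gt0) !(theta2J t_gt0) !zexpD zexpN !exprMn exprVn.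
congr (_ + _); rewrite hnome_half_quarter.
by move: (jtheta _ _) (jtheta _ _) => K1 K2; field.
Qed.

Lemma theta0_half_mul x y : theta0 x (t / 2) * theta0 y (t / 2) =
  theta3 (x + y) t * theta3 (x - y) t - theta2 (x + y) t * theta2 (x - y) t.
Proof.
have [x0 y0] := (zexp_neq0 x, zexp_neq0 y).
rewrite !(theta0J t2_gt0) (jtheta_mul q1 q0 (oz0 x) (oz0 y)) hnome_half.
rewrite !(theta3J t_gt0) !(theta2J t_gt0) !zexpD zexpN !exprMn exprVn.
rewrite mulrNN invrN mulrNN; congr (_ + _); rewrite hnome_half_quarter.
by move: (jtheta _ _) (jtheta _ _) => K1 K2; field.
Qed.

Lemma theta3_theta0_half_mul x y : theta3 x (t / 2) * theta0 y (t / 2) =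
  theta0 (x + y) t * theta0 (x - y) t - theta1 (x + y) t * theta1 (x - y) t.
Proof.
have [x0 y0] := (zexp_neq0 x, zexp_neq0 y).
rewrite (theta3J t2_gt0) (theta0J t2_gt0) (jtheta_mul q1 q0 (z0 x) (oz0 y)) hnome_half.
rewrite !(theta0J t_gt0) !(theta1J t_gt0) !zexpD zexpN !exprMn exprVn.
have eM := mulrN (zexp x ^+ 2) (zexp y ^+ 2).
have eV : zexp x ^+ 2 / - zexp y ^+ 2 = - (zexp x ^+ 2 / zexp y ^+ 2).
  by rewrite invrN mulrN.
rewrite eM eV hnome_half_quarter; congr (_ + _).
move: (jtheta _ _) (jtheta _ _) => K1 K2.
transitivity (- ('i ^+ 2) * (zexp (t / 4) ^+ 2 * zexp x ^+ 2) * (K1 * K2)).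
  by rewrite sqrCi; ring.
by field.
Qed.

(** Exchanging [x] and [y] negates [x - y], and only [theta1] is odd. *)
Lemma theta0_theta3_half_mul x y : theta0 x (t / 2) * theta3 y (t / 2) =
  theta0 (x + y) t * theta0 (x - y) t + theta1 (x + y) t * theta1 (x - y) t.
Proof.
have E s d : s = x + y -> d = - (x - y) ->
    theta0 s t * theta0 d t - theta1 s t * theta1 d t =
    theta0 (x + y) t * theta0 (x - y) t + theta1 (x + y) t * theta1 (x - y) t.
  by move=> -> ->; rewrite (theta0N t_gt0) (theta1N t_gt0) mulrN opprK.
apply: etrans (mulrC _ _) (etrans (theta3_theta0_half_mul y x) _).
exact: (E _ _ (addrC y x) (esym (opprB x y))).
Qed.

End HalfModulus.

(** * Products of two components and the action of [Q] *)

Section ProductExpansion.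
Variable F : fieldType.
Hypothesis two_neq0 : (2 : F) != 0.
Variables (T0 T1 T2 T3 H0 H3 : F -> F).
Hypothesis T0N : forall u, T0 (- u) = T0 u.
Hypothesis T1N : forall u, T1 (- u) = - T1 u.
Hypothesis T2N : forall u, T2 (- u) = T2 u.
Hypothesis T3N : forall u, T3 (- u) = T3 u.
Hypothesis H33 : forall x y,
  H3 x * H3 y = T3 (x + y) * T3 (x - y) + T2 (x + y) * T2 (x - y).
Hypothesis H00 : forall x y,
  H0 x * H0 y = T3 (x + y) * T3 (x - y) - T2 (x + y) * T2 (x - y).
Hypothesis H30 : forall x y,
  H3 x * H0 y = T0 (x + y) * T0 (x - y) - T1 (x + y) * T1 (x - y).
Hypothesis H03 : forall x y,
  H0 x * H3 y = T0 (x + y) * T0 (x - y) + T1 (x + y) * T1 (x - y).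
Hypothesis T0_sum : forall z h,
  (T0 (z + h) * T1 (z - h) + T0 (z - h) * T1 (z + h)) * (T0 h * T1 h)
  = T0 0 * T1 (2 * h) * (T1 z * T0 z).
Hypothesis T2_sum : forall z h,
  (T2 (z + h) * T1 (z - h) + T2 (z - h) * T1 (z + h)) * (T2 h * T1 h)
  = T2 0 * T1 (2 * h) * (T1 z * T2 z).
Hypothesis T3_sum : forall z h,
  (T3 (z + h) * T1 (z - h) + T3 (z - h) * T1 (z + h)) * (T3 h * T1 h)
  = T3 0 * T1 (2 * h) * (T1 z * T3 z).

Implicit Types (p : bool) (x y z h v S D k : F).

Definition sgnb p : F := if p then 1 else -1.

(* [true] and [false] stand for the signs + and -; as in [psistar], the component
   [theta3] comes with the sign + and [theta0] with the sign -. *)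
Definition dual_pair p1 p2 x y :=
  sgnb p1 * sgnb p2 * ((if p1 then H3 else H0) x * (if p2 then H3 else H0) y).

(** The common normal form of both sides. Unit weights give a dual product up to its [T1] part,
    while the weights [T_i 0 / T_i h] describe what [Q] produces from a fused product. *)
Definition weighted k0 k2 k3 p1 p2 S D :=
  if p1 == p2 then k3 * (T3 S * T3 D) + sgnb p1 * (k2 * (T2 S * T2 D))
  else - (k0 * (T0 S * T0 D)).

Lemma dual_pairE p1 p2 x y : dual_pair p1 p2 x y =
  weighted 1 1 1 p1 p2 (x + y) (x - y)
  + (if p1 == p2 then 0 else sgnb p1 * (T1 (x + y) * T1 (x - y))).
Proof.
by case: p1; case: p2; rewrite /dual_pair /weighted /sgnb /= ?H33 ?H00 ?H30 ?H03; ring.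
Qed.

Lemma weightedN k0 k2 k3 p1 p2 S D :
  weighted k0 k2 k3 p1 p2 S (- D) = weighted k0 k2 k3 p1 p2 S D.
Proof. by rewrite /weighted T0N T2N T3N. Qed.

Section Ratios.
Variable h : F.
Hypothesis T0h_neq0 : T0 h != 0.
Hypothesis T2h_neq0 : T2 h != 0.
Hypothesis T3h_neq0 : T3 h != 0.
Hypothesis T3_neq0 : T3 0 != 0.

Let W := weighted (T0 0 / T0 h) (T2 0 / T2 h) (T3 0 / T3 h).

(** With equal arguments the difference is 0: [T1 0 = 0] removes the odd term, and each [T_i 0] is
    [T_i 0 / T_i h] times [T_i h]. *)
Lemma dual_pair_diag p1 p2 x : dual_pair p1 p2 x x = W p1 p2 (x + x) h.
Proof.
have T10 : T1 0 = 0.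
  have /eqP : T1 0 + T1 0 = 0 by rewrite -{1}oppr0 T1N addNr.
  by rewrite -mulr2n -mulr_natl mulf_eq0 (negbTE two_neq0) => /eqP.
rewrite dual_pairE /W /weighted subrr T10.
case: (p1 == p2); first by field; rewrite T3h_neq0 T2h_neq0.
by field; rewrite T0h_neq0.
Qed.

(** The two differences are [v] and [- v], so the even factors [T_i v] come out and the translate
    sums evaluate the rest. The [T1] contributions are [T1 v] and [- T1 v] after division, and
    cancel. *)
Lemma dual_pair_sum p1 p2 z v x y x' y' :
  T1 h != 0 -> T1 (z + h) != 0 -> T1 (z - h) != 0 ->
  x + y = z + h -> x - y = v -> x' + y' = z - h -> x' - y' = - v ->
  dual_pair p1 p2 x y / T1 (z + h) + dual_pair p1 p2 x' y' / T1 (z - h)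
  = T1 (2 * h) * T1 z / (T1 h * T1 (z + h) * T1 (z - h)) * W p1 p2 z v.
Proof.
move=> T1h T1p T1m Exy Dxy Exy' Dxy'.
rewrite !dual_pairE Exy Dxy Exy' Dxy' T1N weightedN /W /weighted.
have ratio (Ti : F -> F) : Ti h != 0 ->
    (Ti (z + h) * T1 (z - h) + Ti (z - h) * T1 (z + h)) * (Ti h * T1 h)
      = Ti 0 * T1 (2 * h) * (T1 z * Ti z) ->
    Ti (z + h) / T1 (z + h) + Ti (z - h) / T1 (z - h) =
    T1 (2 * h) * T1 z / (T1 h * T1 (z + h) * T1 (z - h)) * (Ti 0 / Ti h * Ti z).
  move=> Tih E.
  have -> : Ti 0 / Ti h * Ti z = Ti 0 * Ti z / Ti h by rewrite mulrAC.
  have -> : T1 (2 * h) * T1 z / (T1 h * T1 (z + h) * T1 (z - h)) * (Ti 0 * Ti z / Ti h)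
    = (Ti 0 * T1 (2 * h) * (T1 z * Ti z)) / (Ti h * T1 h * T1 (z + h) * T1 (z - h)).
    by field; rewrite Tih T1h T1p T1m.
  by rewrite -E; field; rewrite Tih T1h T1p T1m.
have r0 := ratio T0 T0h_neq0 (T0_sum z h).
have r2 := ratio T2 T2h_neq0 (T2_sum z h).
have r3 := ratio T3 T3h_neq0 (T3_sum z h).
move: r0 r2 r3; set c := T1 (2 * h) * T1 z / _; move=> r0 r2 r3.
case: (p1 == p2).
  transitivity ((T3 (z + h) / T1 (z + h) + T3 (z - h) / T1 (z - h)) * T3 v
    + sgnb p1 * ((T2 (z + h) / T1 (z + h) + T2 (z - h) / T1 (z - h)) * T2 v)).
    by ring.
  by rewrite r2 r3; ring.
transitivity (- ((T0 (z + h) / T1 (z + h) + T0 (z - h) / T1 (z - h)) * T0 v)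
  + sgnb p1 * (T1 v * (T1 (z + h) / T1 (z + h) - T1 (z - h) / T1 (z - h)))).
  by ring.
by rewrite !divff// r0; ring.
Qed.

(** The sum and difference of [H3 x * H3 y] and [H0 x * H0 y] isolate the [T3] and [T2] products,
    and the mixed sum isolates [T0]. The prefactor cancels the [T3] ratio contained in [xi] and
    [eta], leaving the ratios of [T0] and [T2]. *)
Lemma weighted_quadratic p1 p2 x y (xi eta : F) :
  xi = - (1 / 2) * ((T0 0 * T3 h) / (T0 h * T3 0)) ->
  eta = - ((T2 0 * T3 h) / (T2 h * T3 0)) ->
  T3 0 / T3 h * (if p1 == p2 then
     2^-1 * (1 + sgnb p1 * eta) * (H0 x * H0 y) + 2^-1 * (1 - sgnb p1 * eta) * (H3 x * H3 y)
     else xi * (H0 x * H3 y + H3 x * H0 y))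
  = W p1 p2 (x + y) (x - y).
Proof.
move=> -> ->; rewrite /W /weighted H00 H33 H03 H30.
by case: (p1 == p2); field; rewrite ?T0h_neq0 ?T2h_neq0 ?T3h_neq0 ?T3_neq0 ?two_neq0.
Qed.

End Ratios.

End ProductExpansion.

(** * Intertwining vectors *)

Section Vectors.
Context {R : realType}.
Variables K K' lam : R[i].
Hypothesis tau_gt0 : 0 < complex.Im (tau K K').

Local Notation t := (tau K K').
Local Notation r := (rpar K' lam).
Local Notation br := (bracket K K' lam).
Local Notation dpair :=
  (dual_pair (fun x => theta0 x (t / 2)) (fun x => theta3 x (t / 2))).

Lemma sgnV_sgnb (e : 'I_2) : (sgnV e)%:~R = sgnb R[i] (e == 0).
Proof. by case: e => [[|[|]]]. Qed.

Lemma rev_ord2_eq0 (e : 'I_2) : (rev_ord e == 0) = (e != 0).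
Proof. by case: e => [[|[|]]]. Qed.

(** The reversed sign in [psistar] selects [theta3] for [+] and [theta0] for [-], which is the
    convention of [dual_pair]. *)
Lemma psistar_mul (u : R[i]) (a b c : int) (e1 e2 : 'I_2) :
  psistar K K' lam (u + 1) c b e1 * psistar K K' lam u a c e2 =
  (c - b)%:~R * (a - c)%:~R * Cst K K' lam ^+ 4
     / (4 * br b%:~R * br (u + 1) * (br c%:~R * br u))
  * dpair (e1 == 0) (e2 == 0)
      (((c - b)%:~R * u + c%:~R) / (2 * r))
      (((a - c)%:~R * (u - 1) + a%:~R) / (2 * r)).
Proof.
have revE (e : 'I_2) x : (if rev_ord e == 0 then @theta0 R else @theta3 R) x (t / 2)
    = (if e == 0 then fun x => theta3 x (t / 2) else fun x => theta0 x (t / 2)) x.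
  by rewrite rev_ord2_eq0; case: (e == 0).
rewrite /psistar /psi !mxE !revE !sgnV_sgnb addrK /dual_pair.
(* Over an abstract field this is a [ring] identity, since inversion is multiplicative even at 0. *)
have alg (F : fieldType) (s1 s2 d1 d2 C b0 b1 b2 b3 H1 H2 : F) :
    - s1 * (d1 / (2 * b0 * b1)) * C ^+ 2 * H1
      * (- s2 * (d2 / (2 * b2 * b3)) * C ^+ 2 * H2)
    = d1 * d2 * C ^+ 4 / (4 * b0 * b1 * (b2 * b3)) * (s1 * s2 * (H1 * H2)).
  rewrite !invfM.
  have -> : (4 : F)^-1 = 2^-1 * 2^-1 by rewrite -invfM -natrM.
  by ring.
exact: alg.
Qed.

Lemma Qmx_mul_psi2 (u : R[i]) (a b c : int) (m : 'I_3) (e1 e2 : 'I_2) :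
  let x := ((a - c)%:~R * (u + 1) + a%:~R) / (2 * r) in
  let y := ((c - b)%:~R * u + c%:~R) / (2 * r) in
  sgnV e1 + sgnV e2 = weight2 m ->
  \sum_(m' < 3) Qmx K K' lam m m' * psi2 K K' lam u a c b m' =
  if (e1 == 0) == (e2 == 0) then
    2^-1 * (1 + sgnb _ (e1 == 0) * eta2 K K' lam)
      * (theta0 x (t / 2) * theta0 y (t / 2))
    + 2^-1 * (1 - sgnb _ (e1 == 0) * eta2 K K' lam)
      * (theta3 x (t / 2) * theta3 y (t / 2))
  else xi2 K K' lam * (theta0 x (t / 2) * theta3 y (t / 2)
                       + theta3 x (t / 2) * theta0 y (t / 2)).
Proof.
move=> x y em.
have psi2E m' : psi2 K K' lam u a c b m' = nth 0
   [:: theta0 x (t / 2) * theta0 y (t / 2);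
       theta0 x (t / 2) * theta3 y (t / 2) + theta3 x (t / 2) * theta0 y (t / 2);
       theta3 x (t / 2) * theta3 y (t / 2)] m'.
  rewrite /psi2 coordV2E /symproj /tens /psi !mxE !big_ord1 !mxE /= -/x -/y.
  move: (theta0 x _) (theta3 x _) (theta0 y _) (theta3 y _) => A B C D.
  by congr (nth 0 _ m'); congr [:: _; _; _]; field.
rewrite !big_ord_recl big_ord0 !psi2E !mxE /=.
move: (theta0 x _) (theta3 x _) (theta0 y _) (theta3 y _) => A B C D.
move: (eta2 _ _ _) (xi2 _ _ _) => eta xi.
case: m e1 e2 em => [[|[|[|//]]] ?] [[|[|//]] ?] [[|[|//]] ?] //= _; rewrite /sgnb /=.
all: by field.
Qed.

(** This hides the theta ratios behind an abstract [W] and passes from [theta1] to brackets. The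
    height computations then use only the evenness of [W], its two dual evaluations and its fused
    one. *)
Lemma bracket_weighted :
  theta3 0 t != 0 -> theta0 (1 / r) t != 0 -> theta2 (1 / r) t != 0 ->
  theta3 (1 / r) t != 0 ->
  exists W : bool -> bool -> R[i] -> R[i] -> R[i],
  [/\ forall p1 p2 S D, W p1 p2 S (- D) = W p1 p2 S D,
      forall p1 p2 x, dpair p1 p2 x x = W p1 p2 (x + x) (1 / r),
      forall p1 p2 (b v x y x' y' : R[i]), br 1 != 0 ->
        br (b + 1) != 0 -> br (b - 1) != 0 ->
        x + y = (b + 1) / r -> x - y = v -> x' + y' = (b - 1) / r -> x' - y' = - v ->
        dpair p1 p2 x y / br (b + 1) + dpair p1 p2 x' y' / br (b - 1)
        = br 2 * br b / (br 1 * br (b + 1) * br (b - 1)) * W p1 p2 (b / r) v &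
      forall p1 p2 x y,
        theta3 0 t / theta3 (1 / r) t * (if p1 == p2 then
          2^-1 * (1 + sgnb _ p1 * eta2 K K' lam)
            * (theta0 x (t / 2) * theta0 y (t / 2))
          + 2^-1 * (1 - sgnb _ p1 * eta2 K K' lam)
            * (theta3 x (t / 2) * theta3 y (t / 2))
          else xi2 K K' lam * (theta0 x (t / 2) * theta3 y (t / 2)
                               + theta3 x (t / 2) * theta0 y (t / 2)))
        = W p1 p2 (x + y) (x - y)].
Proof.
move=> n3 n0r n2r n3r.
have two_neq0 : (2 : R[i]) != 0 by rewrite pnatr_eq0.
pose f0 u := theta0 u t; pose f1 u := theta1 u t.
pose f2 u := theta2 u t; pose f3 u := theta3 u t.
pose g0 u := theta0 u (t / 2); pose g3 u := theta3 u (t / 2).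
exists (weighted f0 f2 f3
  (theta0 0 t / theta0 (1 / r) t) (theta2 0 t / theta2 (1 / r) t)
  (theta3 0 t / theta3 (1 / r) t)).
split.
- move=> p1 p2 S D; apply: weightedN => x;
  [exact: theta0N|exact: theta2N|exact: theta3N].
- move=> p1 p2 x.
  have H := @dual_pair_diag _ two_neq0 f0 f1 f2 f3 g0 g3 (theta1N tau_gt0)
    (theta3_half_mul tau_gt0) (theta0_half_mul tau_gt0)
    (theta3_theta0_half_mul tau_gt0) (theta0_theta3_half_mul tau_gt0).
  exact: (H (1 / r) n0r n2r n3r p1 p2 x).
- move=> p1 p2 b v x y x' y' b1 bp bm Exy Dxy Exy' Dxy'.
  have := @dual_pair_sum _ f0 f1 f2 f3 g0 g3 (theta0N tau_gt0) (theta1N tau_gt0) (theta2N tau_gt0)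
    (theta3N tau_gt0) (theta3_half_mul tau_gt0)
    (theta0_half_mul tau_gt0) (theta3_theta0_half_mul tau_gt0)
    (theta0_theta3_half_mul tau_gt0)
    (theta0_translate_sum tau_gt0) (theta2_translate_sum tau_gt0)
    (theta3_translate_sum tau_gt0) (1 / r) n0r n2r n3r p1 p2 (b / r) v x y x' y'.
  move=> H.
  have zp : (b + 1) / r = b / r + 1 / r by rewrite mulrDl.
  have zm : (b - 1) / r = b / r - 1 / r by rewrite mulrBl.
  have z2 : 2 / r = 2 * (1 / r) by rewrite mul1r.
  have nz w : br w != 0 -> Cst K K' lam != 0 /\ f1 (w / r) != 0.
    by rewrite /bracket mulf_eq0 negb_or => /andP[].
  have [[C0 {}b1] [_ {}bp] [_ {}bm]] := And3 (nz _ b1) (nz _ bp) (nz _ bm).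
  rewrite /bracket zp zm z2.
  rewrite zp in Exy bp; rewrite zm in Exy' bm.
  have {}H := H b1 bp bm Exy Dxy Exy' Dxy'.
  (* Both sides are homogeneous of degree -1 in the bracket constant [C]. *)
  have alg (F : fieldType) (C d1 d2 t1 t2 tz th t2h w : F) :
      C != 0 -> t1 != 0 -> t2 != 0 -> th != 0 ->
      d1 / t1 + d2 / t2 = t2h * tz / (th * t1 * t2) * w ->
      d1 / (C * t1) + d2 / (C * t2)
      = C * t2h * (C * tz) / (C * th * (C * t1) * (C * t2)) * w.
    move=> C_ t1_ t2_ th_ E.
    transitivity (C^-1 * (d1 / t1 + d2 / t2)); first by field; rewrite C_ t1_ t2_.
    by rewrite E; field; rewrite C_ t1_ t2_ th_.
  exact: (alg _ _ _ _ _ _ _ _ _ _ C0 bp bm b1 H).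
- move=> p1 p2 x y.
  have H := @weighted_quadratic _ two_neq0 f0 f1 f2 f3 g0 g3 (theta3_half_mul tau_gt0)
    (theta0_half_mul tau_gt0) (theta3_theta0_half_mul tau_gt0)
    (theta0_theta3_half_mul tau_gt0).
  exact: (H (1 / r) n0r n2r n3r n3 p1 p2 x y _ _ erefl erefl).
Qed.

End Vectors.

(** * Gauge factors *)

Section GaugeFactors.
Context {R : realType}.
Variables (K K' lam : R[i]) (eps sq : int -> R[i]).
Hypothesis eps_sign : forall h : int, eps h = 1 \/ eps h = -1.
Hypothesis eps_alt : forall h : int, eps h * eps (h + 1) = (-1) ^ h.
Local Notation br := (bracket K K' lam).
Hypothesis sqE : forall h : int, sq h ^+ 2 = br h%:~R.

Lemma brprod3 (A : int) :
  brprod K K' lam A (A + 2) = br A%:~R * br (A + 1)%:~R * br (A + 2)%:~R.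
Proof.
rewrite /brprod; have -> : absz (A + 2 - A)%R = 2%N by lia.
by rewrite big_mkord !big_ord_recl big_ord0 /= mulr1 addr0 !intrD mulrA.
Qed.

(** Insert [eps (h + 1)] twice, its square being 1: the product is [(-1)^h (-1)^(h + 1) = -1]. *)
Lemma eps_mul_shift2 (h : int) : eps h * eps (h + 2) = -1.
Proof.
have sq1 : eps (h + 1) * eps (h + 1) = 1.
  by case: (eps_sign (h + 1)) => ->; rewrite ?mulrNN mulr1.
transitivity (eps h * eps (h + 1) * (eps (h + 1) * eps (h + 1 + 1))).
  rewrite -addrA mulrA -(mulrA (eps h)) sq1 mulr1; congr (_ * eps _); lia.
have sqN1 : (-1) ^ h * (-1) ^ h = 1 :> R[i].
  by rewrite -exprzMl ?unitrN1// mulrNN mulr1 exp1rz.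
by rewrite !eps_alt exprzDr ?unitrN1// expr1z mulrA sqN1 mul1r.
Qed.

(** The roots [sq b] cancel, [sq a] occurs squared and cancels the factor [[a]] of the bracket
    product, and a sign is its own inverse. What remains is [s * Y / X], where [X] holds the other
    two brackets. *)
Lemma gauge_ratio (a b : int) (s X Y : R[i]) :
  br a%:~R != 0 -> br b%:~R != 0 -> X != 0 -> Y != 0 -> eps b * eps a = s ->
  brprod K K' lam ((a + b - 2) %/ 2)%Z ((a + b + 2) %/ 2)%Z = br a%:~R * X ->
  brbin K K' lam 2 (gauge2_idx a b) = Y ->
  gauge eps sq a / (gauge eps sq b * gauge2 K K' lam sq a b) = s * Y / X.
Proof.
move=> a0 b0 X0 Y0 es pE bE; rewrite /gauge /gauge2 pE bE -(sqE a).
have sa : sq a != 0 by have := a0; rewrite -sqE expf_eq0.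
have sb : sq b != 0 by have := b0; rewrite -sqE expf_eq0.
have eb : eps b != 0 by case: (eps_sign b) => ->; rewrite ?oppr_eq0 oner_eq0.
have ebb : eps b ^+ 2 = 1 by case: (eps_sign b) => ->; rewrite ?sqrrN expr1n.
transitivity (eps b * eps a * Y / X / eps b ^+ 2).
  by field; rewrite sa sb eb X0 Y0.
by rewrite es ebb divr1.
Qed.

Lemma brbin20 : brbin K K' lam 2 0 = 1.
Proof. by rewrite /brbin /brbin_den !big_ord0 divr1. Qed.

Lemma brbin21 : brbin K K' lam 2 1 = br 2 / br 1.
Proof. by rewrite /brbin /brbin_den !big_ord1 !subr0. Qed.

Lemma brbin22 : brbin_den K K' lam 2 != 0 -> brbin K K' lam 2 2 = 1.
Proof. exact: divff. Qed.

Lemma brbin_den1 : brbin_den K K' lam 1 = br 1.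
Proof. by rewrite /brbin_den big_ord1 subr0. Qed.

Lemma gauge_ratio_up (b : int) : let a := b + 1 + 1 in let c := b + 1 in
  br a%:~R != 0 -> br b%:~R != 0 -> br c%:~R != 0 ->
  brbin_den K K' lam (gauge2_idx a b) != 0 ->
  gauge eps sq a / (gauge eps sq b * gauge2 K K' lam sq a b)
  = -1 * 1 / (br b%:~R * br c%:~R).
Proof.
move=> a c a0 b0 c0.
have ab : a = b + 2 by rewrite /a -addrA.
have iE : gauge2_idx a b = 2%N by rewrite /gauge2_idx /a; clear; lia.
rewrite iE => den0.
apply: (gauge_ratio a0 b0 (X := br b%:~R * br c%:~R) (Y := 1)).
- by rewrite mulf_eq0 negb_or b0 c0.
- exact: oner_neq0.
- by rewrite ab; exact: eps_mul_shift2.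
- have -> : ((a + b - 2) %/ 2)%Z = b by rewrite /a; clear; lia.
  have -> : ((a + b + 2) %/ 2)%Z = b + 2 by rewrite /a; clear; lia.
  by rewrite brprod3 -ab mulrC.
- by rewrite iE; exact: brbin22.
Qed.

Lemma gauge_ratio_down (b : int) : let a := b - 1 - 1 in let c := b - 1 in
  br a%:~R != 0 -> br b%:~R != 0 -> br c%:~R != 0 ->
  gauge eps sq a / (gauge eps sq b * gauge2 K K' lam sq a b)
  = -1 * 1 / (br b%:~R * br c%:~R).
Proof.
move=> a c a0 b0 c0.
have ba : b = a + 2 by rewrite /a; clear; lia.
have ca : c = a + 1 by rewrite /a /c; clear; lia.
have iE : gauge2_idx a b = 0%N by rewrite /gauge2_idx /a; clear; lia.
apply: (gauge_ratio a0 b0 (X := br b%:~R * br c%:~R) (Y := 1)).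
- by rewrite mulf_eq0 negb_or b0 c0.
- exact: oner_neq0.
- by rewrite mulrC ba; exact: eps_mul_shift2.
- have -> : ((a + b - 2) %/ 2)%Z = a by rewrite /a; clear; lia.
  have -> : ((a + b + 2) %/ 2)%Z = a + 2 by rewrite /a; clear; lia.
  by rewrite brprod3 -ba -ca -mulrA [_ * br b%:~R]mulrC.
- by rewrite iE; exact: brbin20.
Qed.

Lemma gauge_ratio_diag (b : int) :
  br b%:~R != 0 -> br (b + 1)%:~R != 0 -> br (b - 1)%:~R != 0 ->
  brbin K K' lam 2 (gauge2_idx b b) != 0 ->
  gauge eps sq b / (gauge eps sq b * gauge2 K K' lam sq b b)
  = 1 * (br 2 / br 1) / (br (b - 1)%:~R * br (b + 1)%:~R).
Proof.
move=> b0 bp bm.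
have -> : gauge2_idx b b = 1%N by rewrite /gauge2_idx; clear; lia.
rewrite brbin21 => Y0.
apply: (gauge_ratio b0 b0
  (X := br (b - 1)%:~R * br (b + 1)%:~R) (Y := br 2 / br 1)).
- by rewrite mulf_eq0 negb_or bp bm.
- exact: Y0.
- by case: (eps_sign b) => ->; rewrite ?mulrNN mulr1.
- have -> : ((b + b - 2) %/ 2)%Z = b - 1 by clear; lia.
  have -> : ((b + b + 2) %/ 2)%Z = b - 1 + 2 by clear; lia.
  have e1 : b - 1 + 1 = b by clear; lia.
  have e2 : b - 1 + 2 = b + 1 by clear; lia.
  by rewrite brprod3 e1 e2 -mulrA mulrCA.
- have -> : gauge2_idx b b = 1%N by rewrite /gauge2_idx; clear; lia.
  exact: brbin21.
Qed.

End GaugeFactors.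

(** * Intermediate heights of the fused vectors *)

Section FusedSums.
Context {R : realType}.
Variables (K K' lam : R[i]).

Lemma two_step_cases (a b c : int) :
  a - b \in [:: 2; 0; -2] -> `|a - c| = 1 -> `|c - b| = 1 ->
  [\/ a = b + 1 + 1 /\ c = b + 1, a = b - 1 - 1 /\ c = b - 1
    | a = b /\ (c = b + 1 \/ c = b - 1)].
Proof.
rewrite !inE => /or3P[] /eqP ab hac hcb.
- by constructor 1; lia.
- by constructor 3; lia.
- by constructor 2; lia.
Qed.

Lemma psi2star_up u b e1 e2 :
  psi2star K K' lam u (b + 1 + 1) b e1 e2 =
  psistar K K' lam (u + 1) (b + 1) b e1 * psistar K K' lam u (b + 1 + 1) (b + 1) e2.
Proof.
rewrite /psi2star !big_cons big_nil.
have -> : (`|b + 1 - (b + 1 + 1)| == 1) = true by clear; lia.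
have -> : (`|b - 1 - (b + 1 + 1)| == 1) = false by clear; lia.
by rewrite addr0.
Qed.

Lemma psi2star_down u b e1 e2 :
  psi2star K K' lam u (b - 1 - 1) b e1 e2 =
  psistar K K' lam (u + 1) (b - 1) b e1 * psistar K K' lam u (b - 1 - 1) (b - 1) e2.
Proof.
rewrite /psi2star !big_cons big_nil.
have -> : (`|b + 1 - (b - 1 - 1)| == 1) = false by clear; lia.
have -> : (`|b - 1 - (b - 1 - 1)| == 1) = true by clear; lia.
by rewrite addr0.
Qed.

Lemma psi2star_diag u b e1 e2 :
  psi2star K K' lam u b b e1 e2 =
  psistar K K' lam (u + 1) (b + 1) b e1 * psistar K K' lam u b (b + 1) e2
  + psistar K K' lam (u + 1) (b - 1) b e1 * psistar K K' lam u b (b - 1) e2.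
Proof.
rewrite /psi2star !big_cons big_nil.
have -> : (`|b + 1 - b| == 1) = true by clear; lia.
have -> : (`|b - 1 - b| == 1) = true by clear; lia.
by rewrite addr0.
Qed.

End FusedSums.

(** * Dual fused vectors as combinations of fused vectors *)

Unset Implicit Arguments.

Theorem theorem3p4 (R : realType) (K K' lam : R[i])
  (eps sq : int -> R[i]) (u : R[i]) (a b : int) (m : 'I_3)
  (K_neq0 : K != 0) (K'_neq0 : K' != 0) (lam_neq0 : lam != 0)
  (tau_gt0 : 0 < complex.Im (tau K K'))
  (eps_sign : forall h : int, eps h = 1 \/ eps h = -1)
  (eps_alt : forall h : int, eps h * eps (h + 1) = (-1) ^ h)
  (sqE : forall h : int, sq h ^+ 2 = bracket K K' lam h%:~R)
  (ab : a - b \in [:: 2; 0; -2])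
  (bru_neq0 : bracket K K' lam u != 0)
  (bru1_neq0 : bracket K K' lam (u + 1) != 0)
  (bra_neq0 : bracket K K' lam a%:~R != 0)
  (brb_neq0 : bracket K K' lam b%:~R != 0)
  (brc_neq0 : forall c : int, `|c - a| = 1 -> `|c - b| = 1 ->
     bracket K K' lam c%:~R != 0)
  (den_neq0 : brbin_den K K' lam (gauge2_idx a b) != 0)
  (bin_neq0 : brbin K K' lam 2 (gauge2_idx a b) != 0)
  (gauge2_neq0 : gauge2 K K' lam sq a b != 0)
  (theta3_neq0 : theta3 0 (tau K K') != 0)
  (theta0r_neq0 : theta0 (1 / rpar K' lam) (tau K K') != 0)
  (theta2r_neq0 : theta2 (1 / rpar K' lam) (tau K K') != 0)
  (theta3r_neq0 : theta3 (1 / rpar K' lam) (tau K K') != 0) :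
  forall (c : int), `|a - c| = 1 -> `|c - b| = 1 ->
  forall (e1 e2 : 'I_2), sgnV e1 + sgnV e2 = weight2 m ->
  psi2star K K' lam u a b e1 e2 =
    - (Cst K K' lam ^+ 4
       / (4 * bracket K K' lam u * bracket K K' lam (u + 1)))
    * (theta3 0 (tau K K') / theta3 (1 / rpar K' lam) (tau K K'))
    * (gauge eps sq a / (gauge eps sq b * gauge2 K K' lam sq a b))
    * \sum_(m' < 3) Qmx K K' lam m m' * psi2 K K' lam (u - 1) a c b m'.
Proof.
move=> c hac hcb e1 e2 em.
have r_neq0 : rpar K' lam != 0 by rewrite mulf_neq0 ?invr_eq0.
have [W [WN Wdiag Wsum Wquad]] := bracket_weighted tau_gt0
  theta3_neq0 theta0r_neq0 theta2r_neq0 theta3r_neq0.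
pose x := ((a - c)%:~R * (u - 1 + 1) + a%:~R) / (2 * rpar K' lam).
pose y := ((c - b)%:~R * (u - 1) + c%:~R) / (2 * rpar K' lam).
(* By [Wquad] the sum over [Q], with its theta prefactor, is one value of [W], taken at the
   arguments [x] and [y] of the fused vector at [u - 1]. *)
suff main : psi2star K K' lam u a b e1 e2 =
    - (Cst K K' lam ^+ 4 / (4 * bracket K K' lam u * bracket K K' lam (u + 1)))
    * (gauge eps sq a / (gauge eps sq b * gauge2 K K' lam sq a b))
    * W (e1 == 0) (e2 == 0) (x + y) (x - y).
  have rearr (k g w v : R[i]) : k * g * w * v = k * w * (g * v).
    by rewrite -!mulrA (mulrCA g).
  rewrite main [RHS]rearr (Qmx_mul_psi2 K K' lam (u - 1) a b c em); congr (_ * _).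
  exact: (esym (Wquad (e1 == 0) (e2 == 0) x y)).
(* For [a - b = 2 s] there is one intermediate height. The two dual arguments coincide, so [Wdiag]
   applies, while the fused ones differ by [s / r]; evenness of [W] removes the sign [s]. *)
have off_diagonal (s : int) : (s = 1 \/ s = -1) -> a = b + s + s -> c = b + s ->
    psi2star K K' lam u a b e1 e2 =
      psistar K K' lam (u + 1) c b e1 * psistar K K' lam u a c e2 ->
    gauge eps sq a / (gauge eps sq b * gauge2 K K' lam sq a b) =
      -1 * 1 / (bracket K K' lam b%:~R * bracket K K' lam c%:~R) ->
    psi2star K K' lam u a b e1 e2 =
    - (Cst K K' lam ^+ 4 / (4 * bracket K K' lam u * bracket K K' lam (u + 1)))
    * (gauge eps sq a / (gauge eps sq b * gauge2 K K' lam sq a b))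
    * W (e1 == 0) (e2 == 0) (x + y) (x - y).
  move=> hs ha hc -> ->; rewrite psistar_mul.
  have cbs : c - b = s by rewrite hc addrC addKr.
  have acs : a - c = s by rewrite ha hc addrC addKr.
  have aE : a%:~R = b%:~R + s%:~R + s%:~R :> R[i] by rewrite ha !intrD.
  have cE : c%:~R = b%:~R + s%:~R :> R[i] by rewrite hc !intrD.
  have ss : s%:~R * s%:~R = 1 :> R[i] by case: hs => ->; rewrite ?mulrNN mulr1.
  pose X := (s%:~R * u + c%:~R) / (2 * rpar K' lam).
  have YX : (s%:~R * (u - 1) + a%:~R) / (2 * rpar K' lam) = X.
    by rewrite /X aE cE; congr (_ / _); ring.
  have Dxy : x - y = s%:~R * (1 / rpar K' lam).
    have -> : x - y = (2 * s%:~R) / (2 * rpar K' lam).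
      by rewrite /x /y acs cbs aE cE -mulrBl; congr (_ / _); ring.
    by field; rewrite r_neq0.
  have Sxy : x + y = X + X.
    by rewrite /x /y /X acs cbs aE cE -!mulrDl; congr (_ / _); ring.
  have WD S : W (e1 == 0) (e2 == 0) S (s%:~R * (1 / rpar K' lam)) =
              W (e1 == 0) (e2 == 0) S (1 / rpar K' lam).
    by case: hs => ->; rewrite ?mulN1r ?WN ?mul1r.
  rewrite cbs acs YX -/X Wdiag Sxy Dxy WD ss; congr (_ * _).
  have alg (F : fieldType) (k f v v1 vb vc : F) :
      1 * k / (f * vb * v1 * (vc * v)) = - (k / (f * v * v1)) * (-1 * 1 / (vb * vc)).
    by rewrite !invfM; ring.
  exact: alg.
have [[ha hc]|[ha hc]|[ha hc]] := two_step_cases ab hac hcb.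
- have c0 : bracket K K' lam c%:~R != 0.
    by apply: brc_neq0 => //; rewrite distrC.
  apply: (off_diagonal 1) => //; first by left.
    by rewrite ha hc psi2star_up.
  move: bra_neq0 c0 den_neq0; rewrite ha hc => a0 c0 d0.
  exact: (gauge_ratio_up eps_sign eps_alt sqE a0 brb_neq0 c0 d0).
- have c0 : bracket K K' lam c%:~R != 0.
    by apply: brc_neq0 => //; rewrite distrC.
  apply: (off_diagonal (-1)) => //; first by right.
    by rewrite ha hc psi2star_down.
  move: bra_neq0 c0; rewrite ha hc => a0 c0.
  exact: (gauge_ratio_down eps_sign eps_alt sqE a0 brb_neq0 c0).
subst a.
have abs1 (k : int) : `|b + k - b| = `|k| by rewrite addrC addKr.
have bp : bracket K K' lam (b + 1)%:~R != 0 by apply: brc_neq0; rewrite abs1.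
have bm : bracket K K' lam (b - 1)%:~R != 0 by apply: brc_neq0; rewrite abs1.
(* [[1]] is the denominator of the binomial with entries 2 and 1. *)
have b1 : bracket K K' lam 1 != 0.
  have idx : gauge2_idx b b = 1%N by rewrite /gauge2_idx subrr.
  by move: den_neq0; rewrite idx brbin_den1.
have Gdiag := gauge_ratio_diag eps_sign sqE brb_neq0 bp bm bin_neq0.
rewrite Gdiag psi2star_diag !psistar_mul.
have d1 : b + 1 - b = 1 by rewrite addrC addKr.
have d2 : b - (b + 1) = -1 by rewrite opprD addNKr.
have d3 : b - 1 - b = -1 by rewrite addrC addKr.
have d4 : b - (b - 1) = 1 by rewrite opprB addrC subrK.
have ip : (b + 1)%:~R = b%:~R + 1 :> R[i] by rewrite intrD.
have im : (b - 1)%:~R = b%:~R - 1 :> R[i] by rewrite intrD.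
have i1 : (-1)%:~R = -1 :> R[i] by [].
have i2 : 1%:~R = 1 :> R[i] by [].
rewrite d1 d2 d3 d4 i1 i2.
rewrite ip in bp *; rewrite im in bm *.
(* These are the dual arguments through the heights [b + 1] and [b - 1]. Their sums are
   [(b + 1) / r] and [(b - 1) / r] and their differences [u / r] and [- u / r], as [Wsum]
   requires. *)
pose xp := (1 * u + (b%:~R + 1)) / (2 * rpar K' lam).
pose yp := (-1 * (u - 1) + b%:~R) / (2 * rpar K' lam).
pose xm := (-1 * u + (b%:~R - 1)) / (2 * rpar K' lam).
pose ym := (1 * (u - 1) + b%:~R) / (2 * rpar K' lam).
have Exy : xp + yp = (b%:~R + 1) / rpar K' lam by rewrite /xp /yp; field.
have Dxy : xp - yp = u / rpar K' lam by rewrite /xp /yp; field.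
have Exy' : xm + ym = (b%:~R - 1) / rpar K' lam by rewrite /xm /ym; field.
have Dxy' : xm - ym = - (u / rpar K' lam) by rewrite /xm /ym; field.
(* The fused side uses a single [c]. The two choices only change the sign of [x - y], so evenness of
   [W] makes them agree. *)
have Wxy : W (e1 == 0) (e2 == 0) (x + y) (x - y)
         = W (e1 == 0) (e2 == 0) (b%:~R / rpar K' lam) (u / rpar K' lam).
  have Sb : x + y = b%:~R / rpar K' lam.
    by case: hc => hc; rewrite /x /y hc ?d1 ?d2 ?d3 ?d4 i1 i2 ?ip ?im; field.
  rewrite Sb; case: hc => hc.
    have -> : x - y = - (u / rpar K' lam) by rewrite /x /y hc d1 d2 i1 i2 ip; field.
    exact: WN.
  by congr (W _ _ _ _); rewrite /x /y hc d3 d4 i1 i2 im; field.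
rewrite Wxy -/xp -/yp -/xm -/ym.
have := Wsum (e1 == 0) (e2 == 0) _ _ _ _ _ _ b1 bp bm Exy Dxy Exy' Dxy'.
(* The opposite steps through [c] give both terms the coefficient -1. The factor [[b]] of the
   evaluated sum cancels the one in the dual vectors, leaving the gauge ratio [[2] / ([1] [b - 1]
   [b + 1])]. *)
have alg (F : fieldType) (k f v v1 vb vp vm w1 w2 dp dm w : F) : vb != 0 ->
    dp / vp + dm / vm = w2 * vb / (w1 * vp * vm) * w ->
    1 * -1 * k / (f * vb * v1 * (vp * v)) * dp + -1 * 1 * k / (f * vb * v1 * (vm * v)) * dm
    = - (k / (f * v * v1)) * (1 * (w2 / w1) / (vm * vp)) * w.
  move=> vb0 E.
  transitivity (- (k / (f * v * v1)) / vb * (dp / vp + dm / vm)).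
    by rewrite !invfM; ring.
  rewrite E !invfM.
  transitivity (- (k * (f^-1 / v / v1)) * (w2 * (w1^-1 / vp / vm) * w) * (vb / vb)).
    by ring.
  by rewrite divff// mulr1; ring.
exact: alg.
Qed.
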